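(* Let $h\geq 1$, let $c_0,c_1,\ldots,c_h>0$ and $\nu_0,\nu_1,\ldots,\nu_h\in(0,1)$. Let $\{S_1(t)\}_{t\ge 0},\ldots,\{S_h(t)\}_{t\ge 0}$ be real-valued Lévy processes such that each $\kappa_{S_i}(\theta):=\log\mathbb{E}[e^{\theta S_i(1)}]$ ($\theta\in\mathbb{R}$) is finite in a neighborhood of $\theta=0$, and let $\{L_i^{\nu_i}(t)\}_{t\ge 0}$, $i=0,1,\ldots,h$, be inverse stable subordinators of parameters $\nu_i$; all these $2h+1$ processes are independent. Let $\Psi$ be the function defined by $$\Psi(\theta_1,\ldots,\theta_h):=\sum_{i=1}^h(c_i\kappa_{S_i}(\theta_i))^{1/\nu_i}1_{\{\kappa_{S_i}(\theta_i)\geq 0\}}+\left(c_0\sum_{i=1}^h\kappa_{S_i}(\theta_i)\right)^{1/\nu_0}1_{\{\sum_{i=1}^h\kappa_{S_i}(\theta_i)\geq 0\}}$$ for all $(\theta_1,\ldots,\theta_h)\in\mathbb{R}^h$, and assume that $\Psi$ is essentially smooth and lower semicontinuous. Then the family of $\mathbb{R}^h$-valued random variables $$\left\{\left(\frac{S_1(c_1L_1^{\nu_1}(t)+c_0L_0^{\nu_0}(t))}{t},\ldots,\frac{S_h(c_hL_h^{\nu_h}(t)+c_0L_0^{\nu_0}(t))}{t}\right):t>0\right\}$$ satisfies the large deviation principle (as $t\to\infty$) with speed function $t$ and rate function $I_{\mathrm{LD}}$ defined by $$I_{\mathrm{LD}}(x_1,\ldots,x_h):=\sup_{(\theta_1,\ldots,\theta_h)\in\mathbb{R}^h}\left\{\sum_{i=1}^h\theta_ix_i-\Psi(\theta_1,\ldots,\theta_h)\right\}\quad\text{for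 all }(x_1,\ldots,x_h)\in\mathbb{R}^h.$$
   Context: Inverse stable subordinator: for $\nu\in(0,1)$, the stable subordinator of order $\nu$ is the nondecreasing Lévy process $\{S_\nu(t)\}_{t\ge0}$ with $\mathbb{E}[e^{-\lambda S_\nu(t)}]=e^{-t\lambda^\nu}$ for $\lambda\ge 0$; its inverse is $L^\nu(t):=\inf\{s\geq 0:S_\nu(s)>t\}$. The functions $\kappa_{S_i}$ take values in $(-\infty,+\infty]$, with the convention $(+\infty)^{1/\nu}=+\infty$. Large deviation principle (LDP): a speed function is a real-valued function $v_t$ with $v_t\to\infty$ as $t\to\infty$; a rate function is a lower semicontinuous function $I:\mathbb{R}^h\to[0,\infty]$. A family $\{Z(t):t>0\}$ of $\mathbb{R}^h$-valued random variables satisfies the LDP with speed $v_t$ and rate function $I$ if $\limsup_{t\to\infty}\frac{1}{v_t}\log P(Z(t)\in C)\leq-\inf_{x\in C}I(x)$ for all closed $C\subseteq\mathbb{R}^h$ and $\liminf_{t\to\infty}\frac{1}{v_t}\log P(Z(t)\in O)\geq-\inf_{x\in O}I(x)$ for all open $O\subseteq\mathbb{R}^h$. Essentially smooth: a function $\Lambda:\mathbb{R}^h\to(-\infty,\infty]$ with $\mathcal{D}(\Lambda):=\{\theta:\Lambda(\theta)<\infty\}$ is essentially smooth if the interior of $\mathcal{D}(\Lambda)$ is non-empty, $\Lambda$ is differentiable throughout this interior, and $\|\nabla\Lambda(\theta_n)\|\to\infty$ whenever $(\theta_n)$ is a sequence in the interior of $\mathcal{D}(\Lambda)$ converging to a boundary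 point of $\mathcal{D}(\Lambda)$. *)

(* Defs.v *)
From HB Require Import structures.
From mathcomp Require Import all_boot all_order all_algebra.
From mathcomp Require Import all_classical all_reals all_analysis.

Set Implicit Arguments.
Unset Strict Implicit.
Unset Printing Implicit Defensive.

Import Order.TTheory GRing.Theory Num.Theory.
Import numFieldTopology.Exports numFieldNormedType.Exports.

Local Open Scope classical_set_scope.
Local Open Scope ring_scope.

(* A real-valued process (X_t)_{t >= 0} on T is a function X : R -> T -> R; its
   values at negative times are never constrained nor used. *)

Section Processes.
Context {d : measure_display} {T : measurableType d} {R : realType}.
Variable P : probability T R.
Implicit Types X D L : R -> T -> R.

Definition mutually_independent (I : finType) (F : I -> set (set T)) : Prop :=
  forall (J : {set I}) (A : I -> set T),
    (forall i, i \in J -> F i (A i)) ->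
    P (\bigcap_(i in [set` J]) A i) = (\prod_(i in J) P (A i))%E.

Definition process_sigma_algebra X : set (set T) :=
  <<s \bigcup_(t in [set t : R | 0 <= t])
        preimage_set_system setT (X t) measurable >>.

Definition independent_processes (I : finType) (X : I -> R -> T -> R) : Prop :=
  mutually_independent (fun i => process_sigma_algebra (X i)).

Definition cadlag (f : R -> R) : Prop :=
  (forall t, 0 <= t -> f x @[x --> t^'+] --> f t) /\
  (forall t, 0 < t -> cvg (f x @[x --> t^'-])).

Definition independent_increments X : Prop :=
  forall (n : nat) (t : nat -> R), 0 <= t 0%N ->
    (forall k, t k <= t k.+1) ->
    mutually_independent (fun k : 'I_n =>
      preimage_set_system setT (X (t k.+1) \- X (t k)) measurable).

Definition stationary_increments X : Prop :=
  forall (s t : R), 0 <= s -> s <= t ->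
  forall B : set R, measurable B ->
    P ((X t \- X s) @^-1` B) = P (X (t - s) @^-1` B).

(* All paths, and not just almost all, are cadlag: otherwise X evaluated at a
   random time need not be measurable, as (T, P) is not assumed complete. *)
Record levy_process X : Prop := LevyProcess {
  levy_measurable : forall t, 0 <= t -> measurable_fun setT (X t);
  levy_start0 : {ae P, forall w, X 0 w = 0};
  levy_independent : independent_increments X;
  levy_stationary : stationary_increments X;
  levy_cadlag : forall w, cadlag (X ^~ w) }.

Record stable_subordinator (nu : R) D : Prop := StableSubordinator {
  stable_levy : levy_process D;
  stable_nondecreasing :
    {ae P, forall w, forall s t, 0 <= s -> s <= t -> D s w <= D t w};
  stable_laplace : forall t lambda, 0 <= t -> 0 <= lambda ->
    ('E_P[fun w => expR (- lambda * D t w)] = (expR (- t * lambda `^ nu))%:E)%E }.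

(* inf set0 = 0 in R; this convention is only used on the null event that a
   path of D stays below t. *)
Definition inverse_process D : R -> T -> R :=
  fun t w => inf [set s | 0 <= s /\ t < D s w].

Definition inverse_stable_subordinator (nu : R) L : Prop :=
  exists2 D, stable_subordinator nu D &
    forall t w, 0 <= t -> L t w = inverse_process D t w.

(* log E[exp(theta Y)]; lne +oo = +oo. *)
Definition log_mgf (Y : T -> R) (theta : R) : \bar R := lne (mmt_gen_fun P Y theta).

End Processes.

Section LargeDeviations.
Context {R : realType} {h : nat}.
Local Open Scope ereal_scope.
Implicit Types Lambda I : 'rV[R]_h -> \bar R.

Definition effective_domain Lambda : set 'rV[R]_h :=
  [set theta | Lambda theta < +oo].

(* Only meant on the interior of the effective domain, where fine \o Lambda
   agrees with Lambda near theta. *)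
Definition gradient Lambda (theta : 'rV[R]_h) : 'rV[R]_h :=
  (\row_i 'D_(delta_mx 0 i) (fine \o Lambda) theta)%R.

(* The norm of 'rV[R]_h is the max norm; as all norms on R^h are equivalent,
   divergence of the gradient does not depend on this choice. *)
Definition essentially_smooth Lambda : Prop :=
  let D := effective_domain Lambda in
  [/\ forall theta, -oo < Lambda theta,
      D° !=set0,
      forall theta, D° theta -> differentiable (fine \o Lambda) theta &
      forall (u : nat -> 'rV[R]_h) (theta : 'rV[R]_h),
        (forall n, D° (u n)) -> (closure D `\` D°) theta ->
        u @ \oo --> theta ->
        (`|gradient Lambda (u n)| : R)%R @[n --> \oo] --> +oo%R].

Definition rate_function I : Prop :=
  (forall x, 0 <= I x) /\ lower_semicontinuous I.

Definition borel_rV := g_sigma_algebraType (@open 'rV[R]_h).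

Definition large_deviation_principle {d : measure_display}
    {T : measurableType d} (P : probability T R)
    (Z : R -> T -> 'rV[R]_h) (v : R -> R) I : Prop :=
  [/\ forall t, (0 < t)%R -> measurable_fun setT (Z t : T -> borel_rV),
      v t @[t --> +oo%R] --> +oo%R,
      rate_function I,
      forall C : set 'rV[R]_h, closed C ->
        limf_esup (fun t => (v t)^-1%:E * lne (P (Z t @^-1` C))) (+oo%R)
          <= - ereal_inf (I @` C) &
      forall O : set 'rV[R]_h, open O ->
        - ereal_inf (I @` O)
          <= limf_einf (fun t => (v t)^-1%:E * lne (P (Z t @^-1` O))) (+oo%R)].

Definition legendre_transform Lambda (x : 'rV[R]_h) : \bar R :=
  ereal_sup [set (\sum_(i < h) theta 0 i * x 0 i)%R%:E - Lambda theta
            | theta in [set: 'rV[R]_h]].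

(* The index ord0 of c and nu stands for the common clock; lift ord0 i is the
   index of the own clock of the i-th component. *)
Definition Psi (kappa : 'I_h -> R -> \bar R) (c nu : 'I_h.+1 -> R)
    (theta : 'rV[R]_h) : \bar R :=
  \sum_(i < h)
    (if 0 <= kappa i (theta 0%R i)
     then ((c (lift ord0 i))%:E * kappa i (theta 0%R i))
            `^ (nu (lift ord0 i))^-1
     else 0)
  + (if 0 <= \sum_(i < h) kappa i (theta 0%R i)
     then ((c ord0)%:E * \sum_(i < h) kappa i (theta 0%R i)) `^ (nu ord0)^-1
     else 0).

Definition time_changed {T : Type} (S : 'I_h -> R -> T -> R)
    (L : 'I_h.+1 -> R -> T -> R) (c : 'I_h.+1 -> R)
    (t : R) (w : T) : 'rV[R]_h :=
  (\row_i (S i (c (lift ord0 i) * L (lift ord0 i) t w + c ord0 * L ord0 t w) w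
           / t))%R.

End LargeDeviations.

(* Main.v *)
(* The Gärtner-Ellis route.  Conditionally on the clocks the moment generating
   function of the time-changed vector factorises, so that it equals the product
   over the clocks j of E exp(xi_j L_j(t)), with xi_i = c_i kappa_i(theta_i) and
   xi_0 = c_0 \sum_i kappa_i(theta_i).  The inverse stable subordinator satisfies
   (1/t) log E exp(xi L(t)) -> xi^(1/nu) 1_(xi >= 0): the upper bound comes from
   P(L(t) > s) <= P(D(s) <= t) <= exp(l t - s l^nu), the lower one from tilting
   D(s) by l = xi^(1/nu) with s proportional to t.

   In the lower bound of the Gärtner-Ellis theorem, Rockafellar's theorem on the
   relative interior of the domain of the rate function is avoided by a quadratic
   regularisation: Lam(theta) - <theta, x> + eps |theta|^2 / 2 has a minimiser
   theta, which by steepness lies in the interior of the domain, so that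
   y = x - eps theta is the gradient of Lam at theta, hence exposed, while
   y -> x as eps -> 0 and <theta, y> - Lam(theta) <= I(x). *)

Require Import Defs.
From HB Require Import structures.
From mathcomp Require Import all_boot all_order all_algebra.
From mathcomp Require Import all_classical all_reals all_analysis.
From mathcomp Require Import measurable_realfun ring lra.

Import Order.TTheory GRing.Theory Num.Theory.
Import numFieldTopology.Exports numFieldNormedType.Exports.

Local Open Scope classical_set_scope.
Local Open Scope ring_scope.

(** * Independence *)

Section Independence.
Context {R : realType} {d : measure_display} {T : measurableType d}.
Variable P : probability T R.

(** Both lower bounds rest on one elementary inequality, [tilting], in place of a change of measure.
    The complement of a window is covered by finitely many half-spaces, on each of which the
    exponential weight is dominated by an exponential with a slightly shifted parameter.
    Differentiability of the exponent at the unshifted parameter makes the shifted integrals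
    exponentially smaller, so a fixed fraction of the mass stays in the window, where the weight is
    bounded.

    Independence concerns whole processes, while the clocks enter as random times. Conditioning is
    therefore Tonelli's theorem on a product of two copies of the sample space with smaller
    sigma-algebras; right continuity of the paths gives the joint measurability.

    The exponential limits are established only where [Psi] is finite. This suffices: Chernoff
    bounds use only such points, and the lower bound works near an interior minimiser. Convexity of
    [Psi] is read off its formula: each [kappa] is convex, and the positive part raised to the power
    1/nu is convex and nondecreasing. *)

Lemma independent_extend (G : set (set T)) (E : set T) :
  setI_closed G -> G `<=` measurable -> measurable E ->
  (forall A, G A -> P (A `&` E) = (P A * P E)%E) ->
  forall A, <<s G >> A -> P (A `&` E) = (P A * P E)%E.
Proof.
move=> GI Gm mE GE A sA.
have : (<<s G >> `<=` [set A | measurable A /\ P (A `&` E) = (P A * P E)%E]).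
  apply: lambda_system_subset => //; last by move=> B GB; split; [exact: Gm|exact: GE].
  apply/dynkin_lambda_system; split => //.
  - by split => //; rewrite setTI probability_setT mul1e.
  - move=> B [mB PB]; split; first exact: measurableC.
    rewrite setIC -setDE measureD//; last first.
      exact: le_lt_trans (probability_le1 P mE) (ltry 1).
    rewrite [E `&` B]setIC [RHS](_ : _ = (1 - P B) * P E)%E; last first.
      by congr (_ * _)%E; exact: probability_setC.
    transitivity (P E - P B * P E)%E; first by rewrite -PB.
    rewrite -(fineK (fin_num_measure P _ mE)) -(fineK (fin_num_measure P _ mB)).
    by rewrite -EFinM -!EFinB -EFinM mulrBl mul1r.
  - move=> F tF HF; split; first by apply: bigcupT_measurable => n; have [] := HF n.
    rewrite setI_bigcupl !measure_bigcup//=; last 3 first.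
    - by move=> i _; have [] := HF i.
    - by move=> i _; apply: measurableI => //; have [] := HF i.
    - exact: trivIset_setIr.
    rewrite muleC -(fineK (fin_num_measure P _ mE)) -nneseriesZl//.
    by apply: eq_eseriesr => i _; rewrite fineK ?fin_num_measure// muleC (HF i).2.
by move=> /(_ _ sA)[].
Qed.

(** Dynkin's argument is applied to one factor at a time: first with a generator from [H] fixed,
    then with a set of the sigma-algebra generated by [G] fixed. *)
Lemma independent_generated (G H : set (set T)) :
  setI_closed G -> G `<=` measurable -> setI_closed H -> H `<=` measurable ->
  (forall A B, G A -> H B -> P (A `&` B) = (P A * P B)%E) ->
  forall A B, <<s G >> A -> <<s H >> B -> P (A `&` B) = (P A * P B)%E.
Proof.
move=> GI Gm HI Hm GH A B sA sB.
have mA : measurable A.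
  by apply: (smallest_sub _ Gm) sA; exact: sigma_algebra_measurable.
rewrite setIC muleC; apply: (independent_extend _ _ HI Hm mA) sB => C HC.
rewrite setIC muleC; apply: (independent_extend _ _ GI Gm _ _ _ sA); first exact: Hm.
by move=> D GD; exact: GH.
Qed.

(** Independence identifies the joint law with the product of the two laws; the rest is Tonelli. The
    codomains are arbitrary so that [X] and [Y] may be identity maps onto the sample space with a
    coarser sigma-algebra. *)
Lemma independent_fubini {d1 d2} {T1 : measurableType d1} {T2 : measurableType d2}
    (X : T -> T1) (Y : T -> T2) (f : T1 * T2 -> \bar R) :
  measurable_fun setT X -> measurable_fun setT Y ->
  (forall A B, measurable A -> measurable B ->
     P (X @^-1` A `&` Y @^-1` B) = (P (X @^-1` A) * P (Y @^-1` B))%E) ->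
  measurable_fun setT f -> (forall z, 0 <= f z)%E ->
  (\int[P]_w f (X w, Y w) = \int[P]_w' \int[P]_w f (X w, Y w'))%E.
Proof.
move=> mX mY XY mf f0.
pose X' : {mfun T >-> T1} := mfun_Sub (mem_set mX).
pose Y' : {mfun T >-> T2} := mfun_Sub (mem_set mY).
have mXY : measurable_fun setT (fun w => (X w, Y w)) := measurable_fun_pair mX mY.
transitivity (\int[distribution P X' \x distribution P Y']_z f z)%E.
  pose m' : {measure set (T1 * T2) -> \bar R} :=
    measure_function_pushforward__canonical__measure_function_Measure P mXY.
  transitivity (\int[m']_z f z)%E.
    by rewrite ge0_integral_pushforward// => z _.
  apply: eq_measure_integral => A mA _; apply/esym; apply: product_measure_unique => //.
rewrite fubini_tonelli2// ge0_integral_distribution//=.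
- apply: eq_integral => w _; rewrite /fubini_G ge0_integral_distribution//.
  exact: measurableT_comp.
- exact: measurable_fun_fubini_tonelli_G.
- by move=> y; exact: integral_ge0.
Qed.

(** The intersections of one member from each [F i] of a group form a pi-system that generates the
    sigma-algebra of the group, and mutual independence speaks directly about them. *)
Lemma independent_groups {I : finType} (F : I -> set (set T)) (J1 J2 : {set I}) :
  mutually_independent P F ->
  (forall i, sigma_algebra setT (F i)) -> (forall i, F i `<=` measurable) ->
  (forall i, i \in J1 -> i \notin J2) ->
  forall A B, <<s \bigcup_(i in [set` J1]) F i >> A ->
    <<s \bigcup_(i in [set` J2]) F i >> B -> P (A `&` B) = (P A * P B)%E.
Proof.
move=> indF sF mF J12.
have FT i : F i setT by have [s0 sC _] := sF i; rewrite -setC0 -setTD; exact: sC.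
have FI i : setI_closed (F i).
  move=> A B FA FB; rewrite -(sigma_algebra_id (sF i)).
  by apply: (@measurableI _ (g_sigma_algebraType (F i))); exact: sub_sigma_algebra.
pose G (J : {set I}) := [set E | exists2 A : I -> set T,
  (forall i, i \in J -> F i (A i)) & E = \bigcap_(i in [set` J]) A i].
have GI J : setI_closed (G J).
  move=> _ _ [A FA ->] [B FB ->]; exists (fun i => A i `&` B i).
    by move=> i iJ; apply: FI; [exact: FA|exact: FB].
  by rewrite bigcapI.
have Gm J : G J `<=` measurable.
  move=> _ [A FA ->]; apply: fin_bigcap_measurable => // i /= iJ.
  exact/mF/FA.
have FG (J : {set I}) A : <<s \bigcup_(i in [set` J]) F i >> A -> <<s G J >> A.
  apply: sub_sigma_algebra2 => B [i /= iJ FB].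
  exists (fun j => if j == i then B else setT).
    by move=> j jJ; case: eqP => [->//|_]; exact: FT.
  apply/seteqP; split => [w Bw j /= _|w /(_ i iJ)]; last by rewrite eqxx.
  by case: eqP.
move=> A B /FG sA /FG sB.
apply: (independent_generated _ _ (GI J1) (Gm J1) (GI J2) (Gm J2)) sA sB.
move=> _ _ [A' FA ->] [B' FB ->].
(* Merging the two families into one reduces the claim to the product formula over the union of [J1]
   and [J2]. *)
pose C i := if i \in J1 then A' i else B' i.
have CA : \bigcap_(i in [set` J1]) A' i = \bigcap_(i in [set` J1]) C i.
  by apply: eq_bigcapr => i /= iJ; rewrite /C iJ.
have CB : \bigcap_(i in [set` J2]) B' i = \bigcap_(i in [set` J2]) C i.
  apply: eq_bigcapr => i /= iJ; rewrite /C ifF//; apply/negP => /J12.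
  by rewrite iJ.
rewrite CA CB -bigcap_setU.
have FC1 i : i \in J1 -> F i (C i) by move=> iJ; rewrite /C iJ; exact: FA.
have FC2 i : i \in J2 -> F i (C i).
  by move=> iJ; rewrite /C ifF; [exact: FB|apply/negP => /J12; rewrite iJ].
rewrite [X in P X](_ : _ = \bigcap_(i in [set` J1 :|: J2]) C i); last first.
  congr (\bigcap_(i in _) _); apply/seteqP; split => i /=; rewrite inE; first by case=> ->; rewrite ?orbT.
  by move=> /orP.
rewrite !indF//; last by move=> i; rewrite inE => /orP[/FC1|/FC2].
rewrite (bigID (mem J1))/=; congr (_ * _)%E; apply: eq_bigl => i; rewrite inE.
  by case: (boolP (i \in J1)); rewrite ?andbT ?andbF.
by case: (boolP (i \in J1)) => [/J12/negbTE->|]; rewrite ?andbT.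
Qed.

Lemma expectation_prod_independent {I : finType} (F : I -> set (set T))
    (f : I -> T -> R) (J : {set I}) :
  mutually_independent P F ->
  (forall i, sigma_algebra setT (F i)) -> (forall i, F i `<=` measurable) ->
  (forall i B, measurable B -> F i (f i @^-1` B)) -> (forall i w, 0 <= f i w) ->
  (\int[P]_w (\prod_(i in J) f i w)%:E = \prod_(i in J) \int[P]_w (f i w)%:E)%E.
Proof.
move=> indF sF mF Ff f0.
have [n] := ubnP #|J|; elim: n J => // n IH J Jn.
have [->|[i iJ]] := set_0Vmem J.
  rewrite big_set0; under eq_integral do rewrite big_set0.
  by rewrite integral_cst// mul1e; exact: probability_setT.
rewrite (big_setD1 i)//=; under eq_integral do rewrite (big_setD1 i)//=.
rewrite -IH; last by move: Jn; rewrite (cardsD1 i) iJ.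
set g := fun w => \prod_(j in J :\ i) f j w.
have gE : g = fun w => \prod_(j <- enum (J :\ i)%SET) f j w.
  by apply/funext => w; rewrite big_enum.
have mf j : measurable_fun setT (f j) by move=> _ B mB; rewrite setTI; exact/mF/Ff.
have g0 w : 0 <= g w by exact: prodr_ge0.
have mg : measurable_fun setT g.
  by rewrite gE; exact: measurable_prod.
have gF B : measurable B -> <<s \bigcup_(j in [set` J :\ i]) F j >> (g @^-1` B).
  move=> mB; rewrite -[_ @^-1` _]setTI.
  suff : measurable_fun setT (g : g_sigma_algebraType (\bigcup_(j in [set` J :\ i]) F j) -> R).
    by move=> mg'; exact: mg'.
  rewrite gE; apply: measurable_prod => j.
  rewrite mem_enum => jJ _ C mC; rewrite setTI; apply: sub_sigma_algebra.
  by exists j => //; exact: Ff.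
(* The absolute values change nothing along [f i] and [g], but make the integrand nonnegative on the
   whole plane, as Tonelli's theorem asks. *)
have := @independent_fubini _ _ _ _ (f i) g (fun z => (`|z.1| * `|z.2|)%:E) (mf i) mg.
rewrite /=; under eq_integral => w _ do rewrite !ger0_norm//.
move=> ->//; last 2 first.
- move=> A B mA mB.
  apply: (independent_groups F [set i]%SET (J :\ i)) => //.
  + by move=> j; rewrite !inE => /eqP->; rewrite eqxx.
  + by apply: sub_sigma_algebra; exists i; rewrite /= ?inE//; exact: Ff.
  + exact: gF.
- by apply/measurable_EFinP; apply: measurable_funM; apply: measurableT_comp.
transitivity (\int[P]_w' ((\int[P]_w (f i w)%:E) * (g w')%:E))%E.
  apply: eq_integral => w' _; rewrite [RHS]muleC -ge0_integralZl ?lee_fin//.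
    by apply: eq_integral => w _; rewrite !ger0_norm// -EFinM mulrC.
    exact/measurable_EFinP.
  by move=> w _; rewrite lee_fin.
rewrite ge0_integralZl//.
- exact/measurable_EFinP.
- by move=> w' _; rewrite lee_fin.
- by apply: integral_ge0 => w _; rewrite lee_fin.
Qed.

End Independence.

(** * Lévy processes *)

Section RightContinuousSampling.
Context {R : realType}.

(** The least multiple of 1/(n+1) strictly above [t]. Strictness is needed because [t^'+] is a
    punctured neighbourhood. There are countably many values, which gives measurability, and they
    are rational, which gives access to the moments at rational times. *)
Definition grid_above (n : nat) (t : R) : R :=
  (Num.truncn (t * n.+1%:R)).+1%:R / n.+1%:R.

Lemma grid_above_gt n t : 0 <= t -> t < grid_above n t.
Proof.
move=> t0; rewrite /grid_above ltr_pdivlMr ?ltr0n//.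
by have /andP[] := truncn_itv (mulr_ge0 t0 (ler0n R n.+1)).
Qed.

Lemma grid_above_le n t : 0 <= t -> grid_above n t <= t + n.+1%:R^-1.
Proof.
move=> t0; rewrite /grid_above ler_pdivrMr ?ltr0n// mulrDl mulVf ?pnatr_eq0//.
rewrite -natr1 lerD2r.
by have /andP[] := truncn_itv (mulr_ge0 t0 (ler0n R n.+1)).
Qed.

Lemma cvg_grid_above t : 0 <= t -> grid_above n t @[n --> \oo] --> t.
Proof.
move=> t0; apply: (@squeeze_cvgr _ _ _ _ (fun=> t) (fun n => t + n.+1%:R^-1)).
- by near=> n; rewrite grid_above_le// ltW// grid_above_gt.
- exact: cvg_cst.
- rewrite -[X in _ --> X]addr0; apply: cvgD; first exact: cvg_cst.
  exact: cvg_harmonic.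
Unshelve. all: by end_near. Qed.

Lemma cvg_right_continuous_grid_above (f : R -> R) t :
  cadlag f -> 0 <= t -> f (grid_above n t) @[n --> \oo] --> f t.
Proof.
move=> [fr _] t0; have /cvg_at_rightP := fr t t0; apply; split.
  by move=> n; exact: grid_above_gt.
exact: cvg_grid_above.
Qed.

(** By right continuity the map is a pointwise limit of samplings at grid times, and a preimage
    under such a sampling is a countable union of rectangles. Process and clock live on separate
    spaces so that each can carry its own sigma-algebra. *)
Lemma measurable_random_time {d1 d2} {T1 : measurableType d1}
    {T2 : measurableType d2} (X : R -> T1 -> R) (tau : T2 -> R) :
  (forall t, 0 <= t -> measurable_fun setT (X t)) ->
  (forall w, cadlag (X ^~ w)) ->
  measurable_fun setT tau -> (forall w, 0 <= tau w) ->
  measurable_fun setT (fun z : T1 * T2 => X (tau z.2) z.1).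
Proof.
move=> mX cX mtau tau0.
apply: (@measurable_fun_cvg _ _ _ _ (fun n (z : T1 * T2) =>
  X (grid_above n (tau z.2)) z.1)); last first.
  by move=> z _; exact: (cvg_right_continuous_grid_above (X ^~ z.1)).
move=> n _ B mB; rewrite setTI.
pose E k := [set w | k%:R <= tau w * n.+1%:R < k.+1%:R].
rewrite (_ : _ @^-1` B =
    \bigcup_k ((X (k.+1%:R / n.+1%:R) @^-1` B) `*` E k)); last first.
  apply/seteqP; split => [z /= Bz|z [k _ [/= Bz Ek]]].
    exists (Num.truncn (tau z.2 * n.+1%:R)) => //; split => //=.
    by rewrite /E/= truncn_itv// mulr_ge0.
  by rewrite /grid_above (truncn_def Ek).
apply: bigcupT_measurable => k; apply: measurableX.
  by rewrite -[_ @^-1` _]setTI; apply: mX => //; exact: divr_ge0.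
have mtn : measurable_fun setT (fun w => tau w * n.+1%:R).
  exact: measurable_funM.
rewrite (_ : E k = (fun w => tau w * n.+1%:R) @^-1` `[k%:R, k.+1%:R[).
  by rewrite -[_ @^-1` _]setTI; exact: mtn.
by apply/seteqP; split => w; rewrite /E/= in_itv.
Qed.

End RightContinuousSampling.

Lemma cvg_EFin_expR {R : realType} (u : nat -> R) (l : R) :
  u n @[n --> \oo] --> l -> (expR (u n))%:E @[n --> \oo] --> (expR l)%:E.
Proof.
move=> ul; apply: cvg_EFin; first by near=> n.
by apply: (cvg_comp _ _ ul); exact: continuous_expR.
Unshelve. all: by end_near. Qed.

Section LevyExponentialMoments.
Context {R : realType} {d : measure_display} {T : measurableType d}.
Variables (P : probability T R) (X : R -> T -> R).
Hypothesis LX : levy_process P X.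
Variable theta : R.

Let M (t : R) := (\int[P]_w (expR (theta * X t w))%:E)%E.

Let M_ge0 t : (0 <= M t)%E.
Proof. by apply: integral_ge0 => w _; rewrite lee_fin expR_ge0. Qed.

Let mexp (Y : T -> R) : measurable_fun setT Y ->
  measurable_fun setT (fun w => expR (theta * Y w)).
Proof.
by move=> mY; apply: measurableT_comp => //; exact: measurable_funM.
Qed.

Let M_increment (s t : R) : 0 <= s -> 0 <= t ->
  (\int[P]_w (expR (theta * (X (s + t) w - X s w)))%:E)%E = M t.
Proof.
move=> s0 t0; have st0 : 0 <= s + t by exact: addr_ge0.
have mX := levy_measurable LX.
have mD : measurable_fun setT (X (s + t) \- X s).
  by apply: measurable_funB; exact: mX.
pose D' : {mfun T >-> R} := mfun_Sub (mem_set mD).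
pose X' : {mfun T >-> R} := mfun_Sub (mem_set (mX t t0)).
have mg : measurable_fun setT (fun x : R => (expR (theta * x))%:E).
  by apply/measurable_EFinP; apply: measurableT_comp => //; exact: measurable_funM.
have g0 (x : R) : (0 <= (expR (theta * x))%:E)%E by rewrite lee_fin expR_ge0.
transitivity (\int[distribution P D']_x (expR (theta * x))%:E)%E.
  by rewrite ge0_integral_distribution.
transitivity (\int[distribution P X']_x (expR (theta * x))%:E)%E; last first.
  by rewrite ge0_integral_distribution.
apply: eq_measure_integral => A mA _ /=.
have := levy_stationary LX s0 (_ : s <= s + t) mA; rewrite lerDl => /(_ t0).
by rewrite addrAC subrr add0r.
Qed.

Let M_add (s t : R) : 0 <= s -> 0 <= t -> M (s + t) = (M s * M t)%E.
Proof.
move=> s0 t0.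
have mX := levy_measurable LX.
(* The times 0, s, s + t, constant from then on, since [independent_increments] takes an infinite
   nondecreasing sequence. *)
pose u (k : nat) : R := if k is k'.+1 then (if k' is _.+1 then s + t else s) else 0.
have u0 k : 0 <= u k by case: k => [|[|k]] //=; exact: addr_ge0.
have uS k : u k <= u k.+1 by case: k => [|[|k]] //=; rewrite lerDl.
have ind : mutually_independent P (fun k : 'I_2 =>
    preimage_set_system setT (X (u k.+1) \- X (u k)) measurable).
  exact: (levy_independent LX (u0 0%N) uS).
have mf (k : 'I_2) : measurable_fun setT (X (u k.+1) \- X (u k)).
  by apply: measurable_funB; apply: mX.
have H : (\int[P]_w (\prod_(k in [set: 'I_2]%SET)
      expR (theta * (X (u k.+1) w - X (u k) w)))%:E =
    \prod_(k in [set: 'I_2]%SET)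
      \int[P]_w (expR (theta * (X (u k.+1) w - X (u k) w)))%:E)%E.
  apply: (expectation_prod_independent _ _
    (fun (k : 'I_2) w => expR (theta * (X (u k.+1) w - X (u k) w))) _ ind).
  - by move=> k; apply: sigma_algebra_preimage; exact: sigma_algebra_measurable.
  - by move=> k _ [B mB <-]; exact: mf.
  - move=> k B mB.
    exists ((fun x => expR (theta * x)) @^-1` B); last by rewrite setTI.
    have mg : measurable_fun setT (fun x : R => expR (theta * x)).
      by apply: measurableT_comp => //; exact: measurable_funM.
    by rewrite -[_ @^-1` _]setTI; exact: mg.
  - by move=> *; rewrite expR_ge0.
rewrite -(M_increment 0 (s + t))// ?addr_ge0// -(M_increment 0 s)// -(M_increment s t)//.
move: H; rewrite [RHS](eq_bigl predT); last by move=> k; rewrite inE.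
rewrite big_ord_recl big_ord1/= !add0r => <-.
apply: eq_integral => w _; rewrite (eq_bigl predT); last by move=> k; rewrite inE.
rewrite big_ord_recl big_ord1/= -expRD -mulrDr.
by congr (expR _)%:E; ring.
Qed.

(* Multiplicativity settles rational times. At a real time [t], Fatou's lemma along
   a grid decreasing to [t] bounds [M t] from above, and [M t * M (q - t) = M q]
   with [q] rational bounds it from below. *)
Lemma levy_exp_moment kappa :
  M 1 = (expR kappa)%:E -> forall t, 0 <= t -> M t = (expR (t * kappa))%:E.
Proof.
move=> M1.
have M0 : M 0 = 1%E.
  rewrite -(M_increment 0 0)//.
  under eq_integral do rewrite addr0 subrr mulr0 expR0.
  by rewrite integral_cst// mul1e; exact: probability_setT.
have Mnat s r k : 0 <= s -> M s = r%:E -> M (k%:R * s) = (r ^+ k)%:E.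
  move=> s0 Ms; elim: k => [|k IH]; first by rewrite mul0r M0.
  by rewrite -natr1 [(_ + 1) * s]mulrDl mul1r M_add ?mulr_ge0// IH Ms exprSr EFinM.
have Mrat n k : M (k%:R / n.+1%:R) = (expR (k%:R / n.+1%:R * kappa))%:E.
  have n0 : (0 : R) <= n.+1%:R^-1 by rewrite invr_ge0.
  suff Mn : M n.+1%:R^-1 = (expR (n.+1%:R^-1 * kappa))%:E.
    by rewrite (Mnat _ _ _ n0 Mn) -expRM_natl mulrA.
  (* An infinite moment here would force [M 1] to be 0 or +oo by multiplicativity, whereas it is
     finite and positive. In the finite case both sides have the same (n+1)-th power. *)
  have := M_ge0 n.+1%:R^-1; case Mr : (M n.+1%:R^-1) => [r| |]//; last first.
    have : M (n%:R / n.+1%:R + n.+1%:R^-1) = (expR kappa)%:E.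
      rewrite -M1; congr (M _).
      have h : n.+1%:R != 0 :> R by rewrite pnatr_eq0.
      by apply: (mulIf h); rewrite mulrDl mulVf// divfK// natr1 mul1r.
    rewrite M_add ?mulr_ge0// Mr => + _.
    have := M_ge0 (n%:R / n.+1%:R); rewrite le_eqVlt => /predU1P[M0'|Mp].
      by rewrite -M0' mul0e => -[E]; have := expR_gt0 kappa; rewrite -E ltxx.
    by rewrite gt0_muley.
  rewrite lee_fin => r0; congr EFin.
  apply: (@pexpIrn _ n.+1) => //; rewrite ?nnegrE ?expR_ge0//.
  rewrite -expRM_natl mulrA divff ?pnatr_eq0// mul1r.
  by apply: EFin_inj; rewrite -M1 -(Mnat _ _ _ n0 Mr) divff ?pnatr_eq0.
have Mle t : 0 <= t -> (M t <= (expR (t * kappa))%:E)%E.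
  move=> t0.
  have cvM : M (grid_above n t) @[n --> \oo] --> (expR (t * kappa))%:E.
    rewrite /grid_above; under eq_fun do rewrite Mrat.
    apply: cvg_EFin_expR.
    by apply: cvgM; [exact: cvg_grid_above|exact: cvg_cst].
  rewrite -(cvg_limn_einf_sup cvM).1.
  rewrite [leLHS](_ : _ = (\int[P]_w
     limn_einf (fun n => (expR (theta * X (grid_above n t) w))%:E))%E); last first.
    apply: eq_integral => w _; apply/esym.
    have : (expR (theta * X (grid_above n t) w))%:E @[n --> \oo] -->
           (expR (theta * X t w))%:E.
      apply: cvg_EFin_expR.
      apply: cvgM; first exact: cvg_cst.
      exact: (cvg_right_continuous_grid_above _ _ (levy_cadlag LX w)).
    by move=> /cvg_limn_einf_sup[].
  apply: fatou => //.
  move=> n; apply/measurable_EFinP; apply: mexp.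
  by apply: (levy_measurable LX); rewrite ltW// (le_lt_trans _ (grid_above_gt n t t0)).
move=> t t0; apply/eqP; rewrite eq_le Mle//=.
have qt := ltW (grid_above_gt 0 t t0).
have : M (t + (grid_above 0 t - t)) = (expR (grid_above 0 t * kappa))%:E.
  by rewrite addrC subrK /grid_above Mrat.
rewrite M_add ?subr_ge0//.
have := M_ge0 t; have := Mle t t0; case: (M t) => [r| |]// _ r0.
have := M_ge0 (grid_above 0 t - t); have : 0 <= grid_above 0 t - t by rewrite subr_ge0.
move=> /Mle; case: (M _) => [r'| |]//; rewrite !lee_fin => r'le r'0 -[E].
rewrite -(@ler_pM2r _ (expR ((grid_above 0 t - t) * kappa))) ?expR_gt0// -expRD.
by rewrite -mulrDl addrC subrK -E ler_wpM2l.
Qed.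

End LevyExponentialMoments.

(** * Inverse stable subordinators *)

Lemma near_expR_le {R : realType} (b e : R) : 0 < b -> 0 < e ->
  \forall t \near +oo, expR (- (b * t)) <= e.
Proof.
move=> b0 e0; near=> t.
by rewrite -[leRHS]lnK// ler_expR lerNl -ler_pdivrMl.
Unshelve. all: by end_near. Qed.

Lemma derivable_linearization {R : realType} {V : normedModType R}
    (f : V -> R) (a v : V) (D e : R) :
  is_derive a v f D -> 0 < e ->
  exists2 r, 0 < r & forall h : R, `|h| < r ->
    `|f (h *: v + a) - f a - h * D| <= e * `|h|.
Proof.
move=> [df <-] e0.
have cf : h^-1 *: ((f \o shift a) (h *: v) - f a) @[h --> 0^'] --> 'D_v f a := df.
have /cvgr_dist_le /(_ e e0) := cf.
rewrite near_withinE => -[r /= r0 H]; exists r => // h hr.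
have [->|h0] := eqVneq h 0; first by rewrite scale0r add0r subrr mul0r subr0 normr0 mulr0.
have := H h; rewrite /= sub0r normrN => /(_ hr h0).
rewrite -(@ler_pM2r _ `|h|) ?normr_gt0// -normrM => H'.
rewrite -normrN (le_trans _ H')// le_eqVlt; apply/orP; left; apply/eqP.
congr `|_|; rewrite mulrBl /= /shift /=.
rewrite -[X in _ = _ - X]/(h^-1 * (f (h *: v + a) - f a) * h).
by rewrite mulrAC mulVf// mul1r; ring.
Qed.

Section Chernoff.
Context {R : realType} {d : measure_display} {T : measurableType d}.
Variable P : probability T R.

Lemma markov_set (f : T -> R) (A : set T) (c : R) :
  measurable_fun setT f -> measurable A -> (forall w, 0 <= f w) -> 0 <= c ->
  (forall w, A w -> c <= f w) ->
  (c%:E * P A <= \int[P]_w (f w)%:E)%E.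
Proof.
move=> mf mA f0 c0 cf.
rewrite -(setIT A) -integral_indic// -ge0_integralZl//; last first.
  exact/measurable_EFinP.
apply: ge0_le_integral => //.
- by move=> w _; rewrite -EFinM lee_fin mulr_ge0.
- by apply/measurable_EFinP; exact: measurable_funM.
- exact/measurable_EFinP.
move=> w _; rewrite -EFinM lee_fin indicE.
by case: (boolP (w \in A)) => [/set_mem /cf|_]; rewrite ?mulr1 ?mulr0.
Qed.

(* A weight [W] puts on the complement of [G] at most the mass of the
   majorants [V j], hence it bounds the probability of [G] from below. *)
Lemma tilting {J : finType} (W : T -> R) (V : J -> T -> R) (G : set T) (K : R) :
  measurable_fun setT W -> (forall j, measurable_fun setT (V j)) ->
  measurable G -> (forall w, 0 <= W w) -> (forall j w, 0 <= V j w) -> 0 <= K ->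
  (forall w, G w -> W w <= K) -> (forall w, ~ G w -> exists j, W w <= V j w) ->
  (\int[P]_w (W w)%:E <= K%:E * P G + \sum_j \int[P]_w (V j w)%:E)%E.
Proof.
move=> mW mV mG W0 V0 K0 WG WV.
rewrite -(setIT G) -integral_indic// -ge0_integralZl//; last first.
  exact/measurable_EFinP.
rewrite -ge0_integral_sum//; first last.
- by move=> j w _; rewrite lee_fin.
- by move=> j; exact/measurable_EFinP.
rewrite -ge0_integralD//; first last.
- by apply: emeasurable_sum => j; exact/measurable_EFinP.
- by move=> w _; apply: sume_ge0 => j _; rewrite lee_fin.
- by apply/measurable_EFinP; exact: measurable_funM.
- by move=> w _; rewrite -EFinM lee_fin mulr_ge0.
apply: ge0_le_integral => //.
- by move=> w _; rewrite lee_fin.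
- exact/measurable_EFinP.
- apply: emeasurable_funD; first by apply/measurable_EFinP; exact: measurable_funM.
  by apply: emeasurable_sum => j; exact/measurable_EFinP.
move=> w _; rewrite sumEFin -EFinM -EFinD lee_fin indicE.
case: (boolP (w \in G)) => [/set_mem Gw|/negP Gw].
  by rewrite mulr1 (le_trans (WG _ Gw))// lerDl sumr_ge0.
rewrite mulr0 add0r; have [j Wj] := WV w (fun h => Gw (mem_set h)).
by rewrite (le_trans Wj)// (bigD1 j)//= lerDl sumr_ge0.
Qed.

End Chernoff.

Section InverseStable.
Context {R : realType} {d : measure_display} {T : measurableType d}.
Variables (P : probability T R) (nu : R) (D : R -> T -> R).
Hypothesis nu01 : 0 < nu < 1.
Hypothesis SD : stable_subordinator P nu D.

Let mD t : 0 <= t -> measurable_fun setT (D t).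
Proof. exact: (levy_measurable (stable_levy SD)). Qed.

Let lbound0 t w : has_lbound [set s : R | 0 <= s /\ t < D s w].
Proof. by exists 0 => s []. Qed.

Lemma inverse_process_ge0 t w : 0 <= inverse_process D t w.
Proof.
rewrite /inverse_process; have [->|/set0P ne] := eqVneq [set s | 0 <= s /\ t < D s w] set0.
  by rewrite inf0.
by apply: lb_le_inf => // s [].
Qed.

Lemma inverse_process_le t s w : 0 <= s -> t < D s w -> inverse_process D t w <= s.
Proof. by move=> s0 tD; apply: ge_inf. Qed.

(** The witness [u] keeps the set under the infimum non-empty; otherwise the value would be
    [inf set0], that is 0. *)
Lemma inverse_process_ge t s u w : (forall a b, 0 <= a -> a <= b -> D a w <= D b w) ->
  0 <= u -> t < D u w -> D s w <= t -> s <= inverse_process D t w.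
Proof.
move=> nd u0 tu Dst; apply: lb_le_inf; first by exists u.
move=> v [v0 tv]; rewrite leNgt; apply/negP => vs.
by have := lt_le_trans tv (nd v s v0 (ltW vs)); rewrite ltNge Dst.
Qed.

(** For x > 0, the inverse is below x exactly when [D] exceeds [t] at a grid time below x, or never
    exceeds [t] on the grid, where [inf set0 = 0] applies. Right continuity moves any exceedance to
    a slightly later grid time. *)
Lemma measurable_inverse_process t : measurable_fun setT (inverse_process D t).
Proof.
apply: (measurability (@RGenInftyO.G R)); first exact: RGenInftyO.measurableE.
move=> _ [_ [x ->] <-]; rewrite setTI.
pose q (k n : nat) : R := k%:R / n.+1%:R.
pose E k n := [set w | t < D (q k n) w].
have q0 k n : 0 <= q k n by exact: divr_ge0.
have mE k n : measurable (E k n).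
  rewrite (_ : E k n = D (q k n) @^-1` `]t, +oo[); last first.
    by apply/seteqP; split => w; rewrite /E/= in_itv/= andbT.
  by rewrite -[_ @^-1` _]setTI; exact: mD.
have EP s w y : 0 <= s -> t < D s w -> s < y -> exists k n, E k n w /\ q k n < y.
  move=> s0 tD sy.
  have /cvgr_gt /(_ _ tD) [N _ HN] := cvg_right_continuous_grid_above (D ^~ w) s
     (levy_cadlag (stable_levy SD) w) s0.
  have /cvgr_lt /(_ _ sy) [M _ HM] := cvg_grid_above s s0.
  exists (Num.truncn (s * (maxn N M).+1%:R)).+1, (maxn N M); split.
    exact: (HN _ (leq_maxl _ _)).
  exact: (HM _ (leq_maxr _ _)).
have [x0|x0] := leP x 0.
  rewrite (_ : _ @^-1` _ = set0)//; apply/seteqP; split => // w /=.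
  by rewrite in_itv/= => /lt_le_trans /(_ x0); rewrite ltNge inverse_process_ge0.
rewrite (_ : _ @^-1` _ =
    (\bigcup_k \bigcup_n (E k n `&` [set w | q k n < x])) `|`
    ~` \bigcup_k \bigcup_n E k n).
  apply: measurableU; last first.
    by apply: measurableC; apply: bigcupT_measurable => k; exact: bigcupT_measurable.
  apply: bigcupT_measurable => k; apply: bigcupT_measurable => n.
  have [qx|qx] := pselect (q k n < x).
    by rewrite (_ : [set w | q k n < x] = setT) ?setIT//; apply/seteqP; split.
  by rewrite (_ : [set w | q k n < x] = set0) ?setI0//; apply/seteqP; split.
apply/seteqP; split => [w /=|w []]; rewrite /= in_itv/=.
- move=> Lx; have [[k [n Ekn]]|nE] := pselect (exists k n, E k n w); last first.
    by right => -[k _ [n _ Ekn]]; apply: nE; exists k, n.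
  left; have [|s [s0 tD] sx] := inf_lt _ Lx; first by exists (q k n).
  have [k' [n' [Ekn' qx]]] := EP s w x s0 tD sx.
  by exists k' => //; exists n'.
- by move=> [k _ [n _ [Ekn qx]]]; exact: le_lt_trans (inverse_process_le _ _ _ (q0 k n) Ekn) qx.
- move=> nE; rewrite /inverse_process (_ : [set _ | _] = set0) ?inf0//.
  apply/seteqP; split => // s [s0 tD].
  have [k [n [Ekn _]]] := EP s w (s + 1) s0 tD (ltr_pwDr ltr01 (lexx s)).
  by apply: nE; exists k => //; exists n.
Qed.

Lemma stable_laplace_integral t l : 0 <= t -> 0 <= l ->
  (\int[P]_w (expR (- l * D t w))%:E = (expR (- t * l `^ nu))%:E)%E.
Proof. by move=> t0 l0; rewrite -(stable_laplace SD t0 l0) unlock. Qed.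

Let mexp l a t : 0 <= t -> measurable_fun setT (fun w => expR (a + l * D t w)).
Proof.
move=> t0; apply: measurableT_comp => //; apply: measurable_funD => //.
by apply: measurable_funM => //; exact: mD.
Qed.

Let exp_laplace l a t : 0 <= t -> 0 <= l ->
  (\int[P]_w (expR (a - l * D t w))%:E = (expR (a - t * l `^ nu))%:E)%E.
Proof.
move=> t0 l0; under eq_integral => w _ do rewrite expRD -mulNr EFinM.
rewrite ge0_integralZl//.
- by rewrite stable_laplace_integral// -EFinM -expRD mulNr.
- by apply/measurable_EFinP; have := mexp (- l) 0 t t0; under eq_fun do rewrite add0r.
Qed.

Lemma subordinator_small t s l : 0 <= s -> 0 <= l ->
  (P [set w | (D s w <= t)%R] <= (expR (l * t - s * l `^ nu))%:E)%E.
Proof.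
move=> s0 l0; rewrite -exp_laplace// -[leLHS]mul1e; apply: markov_set => //.
- by under eq_fun do rewrite -mulNr; exact: mexp.
- rewrite (_ : [set _ | _] = D s @^-1` `]-oo, t]).
    by rewrite -[_ @^-1` _]setTI; exact: mD.
  by apply/seteqP; split => w; rewrite /= in_itv.
- by move=> w /= Dt; rewrite -[leLHS]expR0 ler_expR -mulrBr mulr_ge0// subr_ge0.
Qed.

Lemma inverse_exp_moment_le xi l : 0 <= xi -> 0 <= l -> xi < l `^ nu ->
  exists2 C, 0 < C & forall t, 0 <= t ->
    (\int[P]_w (expR (xi * inverse_process D t w))%:E <= (C * expR (l * t))%:E)%E.
Proof.
move=> xi0 l0 xil; pose r := expR (xi - l `^ nu).
have r0 : 0 < r by exact: expR_gt0.
have r1 : r < 1 by rewrite -expR0 ltr_expR subr_lt0.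
exists (expR xi + expR (xi *+ 2) / (1 - r)).
  by rewrite addr_gt0 ?divr_gt0 ?expR_gt0// subr_gt0.
move=> t t0.
have mL := measurable_inverse_process t.
(* If k + 1 <= L(t) < k + 2 then D(k) <= t, because D(k) > t would give L(t) <= k. Hence the shift
   by two; the remaining slice L(t) < 1 gives the separate term [expR xi]. *)
pose g (k : nat) w : \bar R :=
  ((expR (xi * k.+2%:R))%:E * (\1_[set w | (D k%:R w <= t)%R] w)%:E)%E.
have mA k : measurable [set w | (D k%:R w <= t)%R].
  rewrite (_ : [set _ | _] = D k%:R @^-1` `]-oo, t]).
    by rewrite -[_ @^-1` _]setTI; exact: mD.
  by apply/seteqP; split => w; rewrite /= in_itv.
have mg k : measurable_fun setT (g k).
  by apply: measurable_funeM; apply/measurable_EFinP.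
have g0 k w : (0 <= g k w)%E by rewrite mule_ge0// lee_fin ?expR_ge0.
have Lg w : ((expR (xi * inverse_process D t w))%:E <=
    (expR xi)%:E + \sum_(0 <= k <oo) g k w)%E.
  have L0 := inverse_process_ge0 t w.
  have /andP[nL Ln] := truncn_itv L0.
  move: nL Ln; case: (Num.truncn _) => [_ L1|n nL Ln].
    rewrite -[leLHS]adde0 leeD ?nneseries_ge0//.
    by rewrite lee_fin ler_expR ler_piMr// ltW.
  rewrite -[leLHS]add0e leeD ?lee_fin ?expR_ge0//.
  apply: (@le_trans _ _ (g n w)); last first.
    apply: le_trans (nneseries_lim_ge n.+1 _) => //.
    by rewrite big_nat_recr//= leeDr// sume_ge0.
  rewrite /g indicE mem_set/= ?mule1.
    by rewrite lee_fin ler_expR ler_wpM2l// ltW.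
  rewrite leNgt; apply/negP => /(inverse_process_le _ _ _ (ler0n _ n)).
  by move/(le_trans nL); rewrite ler_nat ltnn.
apply: (@le_trans _ _ (\int[P]_w ((expR xi)%:E + \sum_(0 <= k <oo) g k w))%E).
  apply: ge0_le_integral => //.
  - apply/measurable_EFinP; apply: measurableT_comp => //.
    exact: measurable_funM.
  - apply: emeasurable_funD => //; apply: ge0_emeasurable_sum => //.
rewrite ge0_integralD//; last 2 first.
- by move=> w _; exact: nneseries_ge0.
- exact: ge0_emeasurable_sum.
rewrite integral_cst//= [P _]probability_setT mule1 mulrDl EFinD leeD//.
  by rewrite lee_fin ler_peMr ?expR_ge0// -expR0 ler_expR mulr_ge0.
rewrite integral_nneseries//; apply: lime_le.
  by apply: is_cvg_nneseries => k _ _; exact: integral_ge0.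
near=> n.
apply: (@le_trans _ _ (\sum_(0 <= k < n) (expR (xi *+ 2) * expR (l * t) * r ^+ k)%:E)%E).
  apply: lee_sum => k _; rewrite /g ge0_integralZl//; last first.
    exact/measurable_EFinP.
  rewrite integral_indic// setIT.
  apply: (le_trans (lee_wpmul2l _ (subordinator_small t k%:R l (ler0n _ k) l0))) => //.
  rewrite -EFinM lee_fin -expRM_natl -!expRD ler_expR.
  rewrite -(natr1 k.+1) -natr1 -mulr_natr le_eqVlt; apply/orP; left; apply/eqP; ring.
rewrite sumEFin lee_fin -mulr_sumr mulrAC ler_pM2r ?expR_gt0//.
rewrite ler_pM2l ?expR_gt0// -[leRHS]mul1r ler_pdivlMr ?subr_gt0// mulrC.
have -> : (1 - r) * (\sum_(0 <= i < n) r ^+ i) = 1 - r ^+ n.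
  by rewrite big_mkord -[1 - r]opprB mulNr -subrX1 opprB.
by rewrite gerBl exprn_ge0// ltW.
Unshelve. all: by end_near. Qed.

Let measurable_sublevel t s : 0 <= s -> measurable [set w | D s w <= t].
Proof.
move=> s0; rewrite (_ : [set _ | _] = D s @^-1` `]-oo, t]).
  by rewrite -[_ @^-1` _]setTI; exact: mD.
by apply/seteqP; split => w; rewrite /= in_itv.
Qed.

Let measurable_exp_inverse xi t :
  measurable_fun setT (fun w => expR (xi * inverse_process D t w)).
Proof.
apply: measurableT_comp => //; apply: measurable_funM => //.
exact: measurable_inverse_process.
Qed.

(** It is enough that the clock stays below [eps * t] with probability at least one half, since then
    the integrand is at least [expR (- eta * t)]. *)
Let inverse_exp_moment_ge_nonpos xi eta : xi <= 0 -> 0 < eta ->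
  \forall t \near +oo, ((2^-1 * expR (- eta * t))%:E <=
    \int[P]_w (expR (xi * inverse_process D t w))%:E)%E.
Proof.
move=> xi0 eta0; have /andP[nu0 nu1] := nu01.
(* This gives [xi * eps >= - eta]; dividing by 1 - xi rather than by - xi includes the case
   [xi = 0]. *)
pose eps := eta / (1 - xi).
have xi1 : 0 < 1 - xi by rewrite subr_gt0 (le_lt_trans xi0).
have eps0 : 0 < eps by exact: divr_gt0.
pose l := (eps / 2) `^ (1 - nu)^-1.
have l0 : 0 < l by rewrite powR_gt0// divr_gt0.
have lE : l = eps / 2 * l `^ nu.
  have nu1' : 1 - nu != 0 by rewrite subr_eq0 eq_sym lt_eqF.
  have E : l `^ (1 - nu) = eps / 2.
    by rewrite -powRrM mulVf// powRr1// ltW// divr_gt0.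
  by rewrite -E -powRD ?subrK ?powRr1 ?ltW// oner_eq0.
near=> t.
have t0 : 0 < t by near: t; exact: nbhs_pinfty_gt.
have s0 : 0 <= eps * t by rewrite mulr_ge0// ltW.
have Pge : ((2^-1)%:E <= P [set w | (t < D (eps * t) w)%R])%E.
  rewrite (_ : [set _ | _] = ~` [set w | (D (eps * t) w <= t)%R]); last first.
    by apply/seteqP; split => w /=; rewrite ltNge => /negP.
  rewrite probability_setC; last exact: measurable_sublevel.
  have := subordinator_small t (eps * t) l s0 (ltW l0).
  rewrite (_ : l * t - eps * t * l `^ nu = - (l * t)); last by rewrite {1 3}lE; field.
  have : expR (- (l * t)) <= 2^-1 by near: t; exact: near_expR_le.
  move=> h1 h2; have := le_trans h2 (_ : _ <= (2^-1)%:E)%E.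
  rewrite lee_fin => /(_ h1).
  have := fin_num_measure P _ (measurable_sublevel t (eps * t) s0).
  by move=> /fineK <-; rewrite -EFinB !lee_fin; lra.
apply: (@le_trans _ _ ((expR (xi * (eps * t)))%:E * P [set w | (t < D (eps * t) w)%R])%E).
  rewrite mulrC EFinM; apply: lee_pmul => //; rewrite lee_fin ?expR_ge0// ler_expR.
  rewrite mulrA ler_pM2r// /eps mulrA ler_pdivlMr//; nra.
apply: markov_set => //.
- rewrite (_ : [set _ | _] = ~` [set w | (D (eps * t) w <= t)%R]); last first.
    by apply/seteqP; split => w /=; rewrite ltNge => /negP.
  by apply: measurableC; exact: measurable_sublevel.
move=> w /= tD; rewrite ler_expR ler_wnM2l//; exact: inverse_process_le.
Unshelve. all: by end_near. Qed.

(** One step [r] serves the two shifted parameters l - r and l + r of the tilting argument; [r < l]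
    keeps the first one positive. *)
Let powR_two_slopes (l p e : R) : 0 < l -> 0 < p -> 0 < e ->
  exists r, [/\ 0 < r, r < l,
    l `^ p - (l - r) `^ p <= r * (p * l `^ (p - 1) + e) &
    r * (p * l `^ (p - 1) - e) <= (l + r) `^ p - l `^ p].
Proof.
move=> l0 p0 e0.
have [r r0 Hr] := derivable_linearization (fun x => x `^ p) l 1 _ e (is_derive1_powR p l0) e0.
pose r' := Num.min (r / 2) (l / 2).
have r'0 : 0 < r' by rewrite lt_min !divr_gt0.
have r'r : r' <= r / 2 by rewrite ge_min lexx.
have r'l : r' <= l / 2 by rewrite ge_min lexx orbT.
have {r'r} r'r : r' < r by lra.
exists r'; split => //; first by lra.
- have := Hr (- r'); rewrite normrN gtr0_norm// scaleNr scaler1 [- r' + l]addrC => /(_ r'r).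
  by rewrite ler_norml => /andP[+ _]; nra.
- have := Hr r'; rewrite gtr0_norm// scaler1 [r' + l]addrC => /(_ r'r).
  by rewrite ler_norml => /andP[+ _]; nra.
Qed.

Let exceeds_almost_surely (t : R) : {ae P, forall w, exists2 u, 0 <= u & t < D u w}.
Proof.
pose N := \bigcap_n [set w | D n%:R w <= t].
have mN : measurable N by apply: bigcapT_measurable => n; exact: measurable_sublevel.
exists N; split => //.
  apply/eqP; rewrite eq_le measure_ge0 andbT; apply/lee_addgt0Pr => e e0; rewrite add0e.
  (* Chernoff's bound with parameter 1 is [expR (t - n)], which is at most [e] once n >= t - ln
     e. *)
  pose n := (Num.truncn `|t - ln e|).+1.
  apply: (@le_trans _ _ (P [set w | (D n%:R w <= t)%R])).
    by apply: le_measure; rewrite ?inE//; [exact: measurable_sublevel|exact: bigcap_inf].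
  apply: le_trans (subordinator_small t n%:R 1 (ler0n _ n) ler01) _.
  rewrite powR1 mul1r mulr1 lee_fin -[leRHS]lnK// ler_expR lerBlDr -lerBlDl ltW//.
  have /andP[_] := truncn_itv (normr_ge0 (t - ln e)).
  by apply: le_lt_trans; exact: ler_norm.
move=> w /= nw n _ /=; rewrite leNgt; apply/negP => tD.
by apply: nw; exists n%:R.
Qed.

(** The inclusion of the two events can fail only on the null set of paths that are not monotone or
    never exceed [t]. *)
Let inverse_tail_ge t s : 0 <= s ->
  (P [set w | (D s w <= t)%R] <= P [set w | (s <= inverse_process D t w)%R])%E.
Proof.
move=> s0; set A := [set w | D s w <= t]; set B := [set w | _].
have mA : measurable A by exact: measurable_sublevel.
have mB : measurable B.
  rewrite (_ : B = inverse_process D t @^-1` `[s, +oo[).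
    by rewrite -[_ @^-1` _]setTI; exact: measurable_inverse_process.
  by apply/seteqP; split => w; rewrite /B/= in_itv/= andbT.
have AB0 : P (A `\` B) = 0%E.
  apply/measure_negligible; first exact: measurableD.
  apply: negligibleS (negligibleU (stable_nondecreasing SD) (exceeds_almost_surely t)) => w [Aw Bw] /=.
  have [nd|nnd] := pselect (forall a b, 0 <= a -> a <= b -> D a w <= D b w); last by left.
  right=> -[u u0 tu]; apply: Bw; exact: inverse_process_ge nd u0 tu Aw.
rewrite -[leRHS]adde0 -AB0; apply: le_trans (measureU2 P mB _); last exact: measurableD.
apply: le_measure; rewrite ?inE//; first by apply: measurableU => //; exact: measurableD.
by move=> w Aw; have [|] := pselect (B w); [left|right].
Qed.

Let inverse_exp_moment_ge_pos xi eta : 0 < xi -> 0 < eta ->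
  \forall t \near +oo, ((2^-1 * expR ((xi `^ nu^-1 - eta) * t))%:E <=
    \int[P]_w (expR (xi * inverse_process D t w))%:E)%E.
Proof.
move=> xi0 eta0; have /andP[nu0 nu1] := nu01.
set l := xi `^ nu^-1.
have l0 : 0 < l by rewrite powR_gt0.
have lxi : l `^ nu = xi by rewrite -powRrM mulVf ?gt_eqF// powRr1// ltW.
(* As [l `^ nu = xi], the factors [expR (xi * s)] and E exp(- l D(s)) cancel; for
   [s = a * t] the mean of [D s] under the tilted law is [(1 - de / 2) * t]. *)
pose de := eta / (l + eta).
have de0 : 0 < de by rewrite divr_gt0// addr_gt0.
have de1 : de < 1 by rewrite ltr_pdivrMr ?addr_gt0// mul1r ltrDr.
have lde : l * de <= eta.
  by rewrite mulrA ler_pdivrMr ?addr_gt0//; nra.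
(* The derivative of the Laplace exponent at [l], hence the mean per unit time of the tilted
   subordinator; [a] then places the mean of D(a t) in the middle of the window from (1 - de) t to
   t. *)
pose m := nu * l `^ (nu - 1).
have m0 : 0 < m by rewrite mulr_gt0// powR_gt0.
pose a := (1 - de / 2) / m.
have a0 : 0 < a by rewrite divr_gt0//; lra.
have am : a * m = 1 - de / 2 by rewrite divfK// gt_eqF.
(* A quarter of [de] is a sufficient margin: (1 - de/2)(1 + de/4) < 1 and (1 - de/2)(1 - de/4) > 1 -
   de. These make [b1] and [b2], the decay rates of the tilted mass above and below the window,
   positive. *)
have e0 : 0 < m * (de / 4) by rewrite mulr_gt0// divr_gt0.
have [r [r0 rl H1 H2]] := powR_two_slopes l nu _ l0 nu0 e0.
rewrite -/m lxi in H1 H2.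
pose b1 := r - a * (xi - (l - r) `^ nu).
pose b2 := a * ((l + r) `^ nu - xi) - r * (1 - de).
have b10 : 0 < b1.
  have := ler_wpM2l (ltW a0) H1.
  rewrite (_ : a * (r * (m + m * (de / 4))) = r * ((a * m) * (1 + de / 4))); last by ring.
  by rewrite am /b1; nra.
have b20 : 0 < b2.
  have := ler_wpM2l (ltW a0) H2.
  rewrite (_ : a * (r * (m - m * (de / 4))) = r * ((a * m) * (1 - de / 4))); last by ring.
  by rewrite am /b2; nra.
near=> t.
have t0 : 0 < t by near: t; exact: nbhs_pinfty_gt.
have s0 : 0 <= a * t by rewrite mulr_ge0// ltW.
have bt1 : expR (- (b1 * t)) <= 4^-1 by near: t; exact: near_expR_le.
have bt2 : expR (- (b2 * t)) <= 4^-1 by near: t; exact: near_expR_le.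
pose G := [set w | (1 - de) * t <= D (a * t) w] `&` [set w | D (a * t) w <= t].
have mG : measurable G.
  rewrite (_ : G = D (a * t) @^-1` `[(1 - de) * t, t]).
    by rewrite -[_ @^-1` _]setTI; exact: mD.
  by apply/seteqP; split => w; rewrite /G/= in_itv/= => /andP.
(* The weight [expR (- l * D)] multiplied by [expR (r * (D - t))], which is at least 1 above the
   window, or by [expr (r * ((1 - de) * t - D))] with the real exponential, which is at least 1
   below it. *)
pose V (j : bool) w := if j then expR (- (r * t) - (l - r) * D (a * t) w)
  else expR (r * ((1 - de) * t) - (l + r) * D (a * t) w).
have mE c b : measurable_fun setT (fun w => expR (c - b * D (a * t) w)).
  by have := mexp (- b) c (a * t) s0; under eq_fun do rewrite mulNr.
have T1 : ((expR (0 - a * t * l `^ nu))%:E <=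
    (expR (- (l * ((1 - de) * t))))%:E * P G + \sum_j \int[P]_w (V j w)%:E)%E.
  rewrite -exp_laplace//; last exact: ltW.
  apply: tilting => //.
  - by case; exact: mE.
  - by case=> w; exact: expR_ge0.
  - by move=> w [/= + _]; rewrite ler_expR sub0r lerN2 ler_pM2l.
  - move=> w /not_andP[] /negP; rewrite -ltNge => DG.
      by exists false; rewrite ler_expR; nra.
    by exists true; rewrite ler_expR; nra.
have V1 : (\int[P]_w (V true w)%:E = (expR (- (a * t * xi)) * expR (- (b1 * t)))%:E)%E.
  rewrite /V exp_laplace ?subr_ge0// ?ltW// -expRD; congr (expR _)%:E.
  by rewrite /b1; ring.
have V2 : (\int[P]_w (V false w)%:E = (expR (- (a * t * xi)) * expR (- (b2 * t)))%:E)%E.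
  rewrite /V exp_laplace ?addr_ge0// ?ltW// -expRD; congr (expR _)%:E.
  by rewrite /b2; ring.
have PG : P G \is a fin_num by exact: fin_num_measure.
have {T1} T1 : expR (xi * (a * t)) * fine (P G) >= 2^-1 * expR (l * ((1 - de) * t)).
  move: T1; rewrite lxi sub0r (bigD1 true)//= (bigD1 false)//= big_pred0; last by case.
  rewrite adde0 V1 V2 -(fineK PG) -EFinM -!EFinD lee_fin.
  rewrite (_ : expR (xi * (a * t)) = (expR (- (a * t * xi)))^-1); last first.
    by rewrite expRN invrK mulrC.
  rewrite (expRN (l * _)).
  have := expR_gt0 (l * ((1 - de) * t)); have := expR_gt0 (- (a * t * xi)).
  set A := expR (- (a * t * xi)); set B := expR (l * _).
  set x1 := expR _ in bt1 *; set x2 := expR _ in bt2 *.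
  move=> A0 B0; rewrite -(ler_pM2l B0) !mulrDr mulVKf ?gt_eqF// => T1.
  rewrite [leRHS]mulrC ler_pdivlMr//.
  have := ler_wpM2l (ltW (mulr_gt0 B0 A0)) bt1.
  have := ler_wpM2l (ltW (mulr_gt0 B0 A0)) bt2.
  move: T1; rewrite !mulrA; lra.
apply: (@le_trans _ _ ((expR (xi * (a * t)))%:E * P G)%E).
  rewrite -(fineK PG) -EFinM lee_fin; apply: le_trans T1.
  by rewrite ler_pM2l// ler_expR mulrA ler_pM2r//; nra.
apply: (@le_trans _ _ ((expR (xi * (a * t)))%:E *
    P [set w | (a * t <= inverse_process D t w)%R])%E).
  apply: lee_wpmul2l => //; apply: le_trans (inverse_tail_ge t _ s0).
  by apply: le_measure; rewrite ?inE//; [exact: measurable_sublevel|move=> w []].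
apply: markov_set => //.
- rewrite (_ : [set _ | _] = inverse_process D t @^-1` `[a * t, +oo[).
    by rewrite -[_ @^-1` _]setTI; exact: measurable_inverse_process.
  by apply/seteqP; split => w; rewrite /= in_itv/= andbT.
- by move=> w /= Lw; rewrite ler_expR ler_pM2l.
Unshelve. all: by end_near. Qed.

(** The exponential growth rate in t of the Mittag-Leffler function of order [nu] at xi t^nu, which
    is the moment generating function of L(t) at [xi]. *)
Definition mittag_leffler_rate (xi : R) := if 0 <= xi then xi `^ nu^-1 else 0.

Lemma inverse_exp_moment_lower xi eta : 0 < eta ->
  \forall t \near +oo, ((2^-1 * expR ((mittag_leffler_rate xi - eta) * t))%:E <=
    \int[P]_w (expR (xi * inverse_process D t w))%:E)%E.
Proof.
move=> eta0; rewrite /mittag_leffler_rate; have /andP[nu0 _] := nu01.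
have [xi0|xi0] := ltP 0 xi; first by rewrite ltW//; exact: inverse_exp_moment_ge_pos.
have -> : (if 0 <= xi then xi `^ nu^-1 else 0) = 0.
  case: ifPn => // xi0'; have -> : xi = 0 by apply/eqP; rewrite eq_le xi0.
  by rewrite powR0// invr_eq0 gt_eqF.
by rewrite sub0r; exact: inverse_exp_moment_ge_nonpos.
Qed.

Lemma inverse_exp_moment_upper xi eta : 0 < eta ->
  exists2 C, 0 < C & forall t, 0 <= t ->
    (\int[P]_w (expR (xi * inverse_process D t w))%:E <=
      (C * expR ((mittag_leffler_rate xi + eta) * t))%:E)%E.
Proof.
move=> eta0; rewrite /mittag_leffler_rate; have /andP[nu0 _] := nu01.
case: ifPn => [xi0|]; last first.
  rewrite -ltNge => xi0; exists 1 => // t t0; rewrite mul1r add0r.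
  apply: (@le_trans _ _ (\int[P]_w (cst 1%E) w)%E).
    apply: ge0_le_integral => //; first exact/measurable_EFinP.
    move=> w _; rewrite lee_fin -expR0 ler_expR nmulr_rle0//.
    exact: inverse_process_ge0.
  rewrite integral_cst//= [P _]probability_setT mul1e lee_fin -expR0 ler_expR.
  by rewrite mulr_ge0// ltW.
apply: inverse_exp_moment_le => //.
  by rewrite addr_ge0// ?powR_ge0// ltW.
have {1}-> : xi = (xi `^ nu^-1) `^ nu by rewrite -powRrM mulVf ?gt_eqF// powRr1.
by rewrite gt0_ltr_powR// ?nnegrE ?powR_ge0// ?addr_ge0// ?powR_ge0 ?ltrDl// ltW.
Qed.

End InverseStable.

(** * Convexity and steepness *)

Lemma continuous_sumr {R : realType} {V : topologicalType} {I : finType} (f : I -> V -> R) :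
  (forall i, continuous (f i)) -> continuous (fun x => \sum_i f i x).
Proof.
move=> cf; have -> : (fun x => \sum_i f i x) = \sum_i f i.
  by apply/funext => x; rewrite fct_sumE.
apply: (big_ind (fun g : V -> R => continuous g)) => //.
- by move=> x; rewrite (_ : 0 = cst 0) //; exact: cst_continuous.
- by move=> g k cg ck x; exact: (continuousD (cg x) (ck x)).
Qed.

Section RowVectors.
Context {R : realType} {h : nat}.
Implicit Types (u v x y theta : 'rV[R]_h).

Definition dotr u v : R := \sum_(i < h) u 0 i * v 0 i.

Lemma dotrDl u v x : dotr (u + v) x = dotr u x + dotr v x.
Proof. by rewrite -big_split; apply: eq_bigr => i _; rewrite mxE mulrDl. Qed.

Lemma dotrZl a u x : dotr (a *: u) x = a * dotr u x.
Proof. by rewrite mulr_sumr; apply: eq_bigr => i _; rewrite mxE mulrA. Qed.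

Lemma dotrC u v : dotr u v = dotr v u.
Proof. by apply: eq_bigr => i _; rewrite mulrC. Qed.

Lemma dotrDr u v x : dotr x (u + v) = dotr x u + dotr x v.
Proof. by rewrite dotrC dotrDl !(dotrC _ x). Qed.

Lemma dotrZr a u x : dotr x (a *: u) = a * dotr x u.
Proof. by rewrite dotrC dotrZl dotrC. Qed.

Lemma dotr_delta i x : dotr (delta_mx 0 i) x = x 0 i.
Proof.
rewrite /dotr (bigD1 i)//= big1 ?addr0; first by rewrite mxE !eqxx mul1r.
by move=> j ji; rewrite mxE (negPf ji) andbF mul0r.
Qed.

Lemma dotr0 x : dotr 0 x = 0.
Proof. by rewrite /dotr big1// => i _; rewrite mxE mul0r. Qed.

Lemma dotr_ge0 x : 0 <= dotr x x.
Proof. by apply: sumr_ge0 => i _; rewrite -expr2 sqr_ge0. Qed.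

Lemma dotr_ge_sqr i x : x 0 i ^+ 2 <= dotr x x.
Proof.
rewrite /dotr (bigD1 i)//= -expr2 lerDl.
by apply: sumr_ge0 => j _; rewrite -expr2 sqr_ge0.
Qed.

Lemma dotr_continuous u : continuous (dotr u).
Proof.
by apply: continuous_sumr => i x; apply: continuousM;
  [exact: cst_continuous|exact: coord_continuous].
Qed.

Lemma rV_norm_lt u e : 0 < e -> (`|u| < e) = [forall i, `|u 0 i| < e].
Proof.
move=> e0; rewrite [ltLHS](mx_normrE u); apply/bigmax_ltP/forallP => [[_ H] i|H].
  exact: (H (0, i)).
by split => // -[i j] _ /=; rewrite (ord1 i).
Qed.

Lemma nbhs_rVP x (A : set 'rV[R]_h) :
  nbhs x A <-> exists2 r, 0 < r & forall y, (forall i, `|y 0 i - x 0 i| < r) -> A y.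
Proof.
split=> [/nbhs_normP[r /= r0 H]|[r r0 H]].
  exists r => // y Hy; apply: H; rewrite /= distrC rV_norm_lt//; apply/forallP => i.
  by rewrite !mxE.
apply/nbhs_ballP; exists r => // y; rewrite -ball_normE /= distrC rV_norm_lt// => /forallP Hy.
by apply: H => i; have := Hy i; rewrite !mxE.
Qed.

End RowVectors.

(** Without a minimiser, the sets where f exceeds f(y), open by semicontinuity, cover [K] as y runs
    over [K]. In a finite subcover the index with the least value is covered by none of them. *)
Lemma lsc_compact_min {R : realType} {V : ptopologicalType} (f : V -> \bar R) (K : set V) :
  lower_semicontinuous f -> (forall x, -oo < f x)%E -> compact K -> K !=set0 ->
  exists2 x, K x & forall y, K y -> (f x <= f y)%E.
Proof.
move=> /lower_semicontinuousP lf fNy; rewrite compact_cover => cK [x0 Kx0].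
apply: contrapT => nmin.
have H x : K x -> exists2 y, K y & (f y < f x)%E.
  move=> Kx; apply: contrapT => nH; apply: nmin; exists x => // y Ky.
  by rewrite leNgt; apply/negP => yx; apply: nH; exists y.
have [||D DK KD] := cK V K (fun y => [set x | f y < f x]%E).
- move=> y _; have := fNy y; rewrite /=; case: (f y) => [r| |]// _.
  rewrite (_ : [set _ | _] = set0); first exact: open0.
  by apply/seteqP; split => // z /=; rewrite ltNge leey.
- by move=> x /H[y Ky yx]; exists y.
suff [z Dz zmin] : exists2 z, z \in finmap.enum_fset D &
    forall y, y \in finmap.enum_fset D -> (f z <= f y)%E.
  have [y /= Dy] := KD z (set_mem (DK z Dz)).
  by rewrite ltNge zmin.
have [z0 Dz0] : exists z, z \in finmap.enum_fset D by have [z Dz _] := KD _ Kx0; exists z.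
suff minP (s : seq V) a : a \in s ->
    exists2 z, z \in s & forall y, y \in s -> (f z <= f y)%E by exact: minP Dz0.
elim: s a => // a s IH _ _.
have [->|[b bs]] : s = [::] \/ exists b, b \in s.
  by case: s {IH} => [|b s]; [left|right; exists b; rewrite mem_head].
  by exists a => [|y]; rewrite ?mem_seq1// => /eqP->.
have [z zs zmin] := IH b bs.
have [az|za] := leP (f a) (f z).
  exists a; rewrite ?mem_head// => y; rewrite inE => /predU1P[->//|/zmin].
  exact: le_trans.
exists z; first by rewrite inE zs orbT.
by move=> y; rewrite inE => /predU1P[->|/zmin//]; exact: ltW.
Qed.

Section EssentiallySmoothConvex.
Context {R : realType} {h : nat}.
Variable Lam : 'rV[R]_h -> \bar R.
Let D := effective_domain Lam.
Hypothesis Lam_ge0 : forall theta, (0 <= Lam theta)%E.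
Hypothesis Lam0 : Lam 0 = 0%E.
Hypothesis Lam_convex : forall (s x y : R) a b, 0 <= s <= 1 ->
  (Lam a <= x%:E)%E -> (Lam b <= y%:E)%E ->
  (Lam (s *: a + (1 - s) *: b) <= (s * x + (1 - s) * y)%:E)%E.
Hypothesis Lam_smooth : essentially_smooth Lam.
Hypothesis Lam_lsc : lower_semicontinuous Lam.
Hypothesis Lam_int0 : (interior D) 0.

Let Lf theta := fine (Lam theta).

Let LamE theta : D theta -> Lam theta = (Lf theta)%:E.
Proof. by move=> Dt; rewrite /Lf fineK// ge0_fin_numE. Qed.

Let D_le x theta : (Lam theta <= x%:E)%E -> D theta.
Proof. by move=> /le_lt_trans; apply; exact: ltry. Qed.

Let Lf_le x theta : (Lam theta <= x%:E)%E -> Lf theta <= x.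
Proof. by move=> Lx; rewrite -lee_fin -LamE//; exact: D_le Lx. Qed.

Let Lf_convex s a b : 0 <= s <= 1 -> D a -> D b ->
  Lf (s *: a + (1 - s) *: b) <= s * Lf a + (1 - s) * Lf b.
Proof. by move=> s01 Da Db; apply/Lf_le/Lam_convex; rewrite ?LamE. Qed.

Let D_convex s a b : 0 <= s <= 1 -> D a -> D b -> D (s *: a + (1 - s) *: b).
Proof.
by move=> s01 Da Db; apply: (@D_le (s * Lf a + (1 - s) * Lf b)); apply: Lam_convex; rewrite ?LamE.
Qed.

(** A ball around 0 inside the domain, shrunk by the factor [s] and moved to (1 - s) b, stays in the
    domain by convexity. *)
Let interior_segment s b : 0 < s <= 1 -> D b -> (interior D) ((1 - s) *: b).
Proof.
move=> /andP[s0 s1] Db; have /nbhs_rVP[r r0 Hr] := Lam_int0.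
apply/nbhs_rVP; exists (s * r); first exact: mulr_gt0.
move=> y Hy.
have -> : y = s *: (s^-1 *: (y - (1 - s) *: b)) + (1 - s) *: b.
  by rewrite scalerA divff ?gt_eqF// scale1r subrK.
apply: D_convex => //; first by rewrite ltW.
apply: Hr => i; rewrite !mxE subr0 normrM gtr0_norm ?invr_gt0// mulrC ltr_pdivrMr//.
by have := Hy i; rewrite !mxE [r * s]mulrC.
Qed.

Lemma derive_gradient p v : (interior D) p ->
  is_derive p v (fine \o Lam) (dotr (gradient Lam p) v).
Proof.
move=> Dp; have [_ _ /(_ p Dp) df _] := Lam_smooth.
apply: DeriveDef; first exact: diff_derivable.
rewrite deriveE// [v in LHS]row_sum_delta linear_sum; apply: eq_bigr => i _.
by rewrite linearZ /= -deriveE// /gradient mxE mulrC.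
Qed.

Lemma gradient_inequality p z : (interior D) p -> D z ->
  Lf p + dotr (gradient Lam p) (z - p) <= Lf z.
Proof.
move=> Dp Dz; rewrite -lerBrDl; apply/ler_addgt0Pr => e e0.
have [r r0 Hr] := derivable_linearization _ _ _ _ _ (derive_gradient p (z - p) Dp) e0.
pose t := Num.min (r / 2) 1.
have t0 : 0 < t by rewrite lt_min divr_gt0/=.
have tr : t <= r / 2 by rewrite ge_min lexx.
have t1 : t <= 1 by rewrite ge_min lexx orbT.
have := Hr t; rewrite gtr0_norm//.
have /[swap] /[apply] : t < r by lra.
rewrite ler_norml => /andP[+ _].
have -> : t *: (z - p) + p = t *: z + (1 - t) *: p.
  by rewrite scalerBr scalerBl scale1r addrAC -addrA.
have := Lf_convex t z p; rewrite ltW//= t1 => /(_ isT Dz (interior_subset Dp)).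
move=> H1; rewrite /= -/(Lf _) -/(Lf p) => H2; rewrite -(ler_pM2l t0); lra.
Qed.

Section Minimizer.
Variables (eps : R) (x : 'rV[R]_h).
Hypothesis eps0 : 0 < eps.

Let u theta := eps / 2 * dotr theta theta - dotr theta x.

Definition regularized theta := (Lam theta + (u theta)%:E)%E.

(** As [Lam] is nonnegative, the quadratic term alone gives coercivity: outside a large cube [u] is
    nonnegative, so no point there beats the value 0 taken at the origin, and a minimum over the
    cube is global. *)
Lemma regularized_minimizer : exists theta, forall theta',
  (regularized theta <= regularized theta')%E.
Proof.
(* Completing the square, the j-th coordinate contributes at least [- q j] to [u]. *)
pose q (j : 'I_h) := x 0 j ^+ 2 / (2 * eps).
have q0 j : 0 <= q j by rewrite divr_ge0 ?sqr_ge0// mulr_ge0// ltW.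
pose B := \sum_j `|x 0 j|; pose Q := \sum_j q j.
have B0 : 0 <= B by exact: sumr_ge0.
have Q0 : 0 <= Q by exact: sumr_ge0.
(* A coordinate beyond [M] contributes at least |theta_i| (eps/2 |theta_i| - B) >= |theta_i| Q >= Q,
   which outweighs all the others. *)
pose M := 2 * (B + Q) / eps + 1.
have M1 : 1 <= M by rewrite lerDr divr_ge0 ?mulr_ge0 ?addr_ge0// ltW.
pose K := [set theta : 'rV[R]_h | forall i, `[- M, M]%classic (theta ord0 i)].
have cK : compact K by apply: (@rV_compact _ _ (fun=> `[- M, M]%classic)) => _; exact: segment_compact.
have uE theta : u theta = \sum_j (eps / 2 * theta 0 j ^+ 2 - theta 0 j * x 0 j).
  by rewrite /u /dotr big_split/= -mulr_sumr sumrN; congr (_ * _ - _); apply: eq_bigr.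
have qle theta j : - q j <= eps / 2 * theta 0 j ^+ 2 - theta 0 j * x 0 j.
  have : 0 <= (eps * theta 0 j - x 0 j) ^+ 2 by exact: sqr_ge0.
  by rewrite /q -mulNr ler_pdivrMr ?mulr_gt0//; nra.
have uout theta : ~ K theta -> 0 <= u theta.
  move=> /existsNP[i]; rewrite /= in_itv/= -ler_norml => /negP; rewrite -ltNge => Mi.
  rewrite uE (bigD1 i)//=.
  have : Q <= eps / 2 * theta 0 i ^+ 2 - theta 0 i * x 0 i.
    have xB : theta 0 i * x 0 i <= `|theta 0 i| * B.
      rewrite (le_trans (ler_norm _))// normrM ler_wpM2l//.
      by rewrite /B (bigD1 i)//= lerDl sumr_ge0.
    have : B + Q <= eps / 2 * `|theta 0 i|.
      have : eps * M <= eps * `|theta 0 i| by rewrite ler_pM2l// ltW.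
      rewrite (_ : eps * M = 2 * (B + Q) + eps); last by rewrite /M; field; rewrite gt_eqF.
      by nra.
    have : 1 <= `|theta 0 i| by rewrite (le_trans M1)// ltW.
    have -> : theta 0 i ^+ 2 = `|theta 0 i| ^+ 2 by rewrite real_normK ?num_real.
    by nra.
  have : - \sum_(j < h | j != i) q j <=
      \sum_(j < h | j != i) (eps / 2 * theta 0 j ^+ 2 - theta 0 j * x 0 j).
    by rewrite -sumrN; apply: ler_sum => j _.
  have : \sum_(j < h | j != i) q j <= Q by rewrite /Q [leRHS](bigD1 i)//= lerDr.
  lra.
have cu : continuous u.
  rewrite (_ : u = fun theta => \sum_j (eps / 2 * (theta 0 j * theta 0 j) - theta 0 j * x 0 j)); last first.
    by apply/funext => th; rewrite uE; apply: eq_bigr => j _; rewrite expr2.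
  apply: continuous_sumr => i y.
  have ci : {for y, continuous (fun th : 'rV[R]_h => th 0 i)} by exact: coord_continuous.
  have c1 : {for y, continuous (fun th : 'rV[R]_h => th 0 i * th 0 i)}.
    exact: (continuousM ci ci).
  have c2 : {for y, continuous (fun th : 'rV[R]_h => eps / 2 * (th 0 i * th 0 i))}.
    by apply: continuousM c1; exact: cst_continuous.
  have c3 : {for y, continuous (fun th : 'rV[R]_h => th 0 i * x 0 i)}.
    by apply: (continuousM ci); exact: cst_continuous.
  exact: (continuousB c2 c3).
have lscF : lower_semicontinuous regularized.
  move=> theta a; rewrite /regularized.
  move=> aL.
  have [b ab bL] : exists2 b : R, a - u theta < b & (b%:E < Lam theta)%E.
    have : ((a - u theta)%:E < Lam theta)%E by rewrite EFinB lteBlDr.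
    case: (Lam theta) (Lam_ge0 theta) => [y| |]//.
      by move=> _; rewrite lte_fin => ay; exists ((a - u theta + y) / 2); rewrite ?lte_fin; lra.
    by exists (a - u theta + 1); rewrite ?ltry//; lra.
  have [A nA HA] := Lam_lsc theta b bL.
  have /cvgr_gt /(_ (a - b)) H2 := cu theta.
  exists (A `&` [set y | a - b < u y]); first by apply: filterI => //; apply: H2; lra.
  move=> y [/HA Ay /= uy].
  apply: (@lt_le_trans _ _ (b%:E + (u y)%:E)%E); last by rewrite leeD2r// ltW.
  by rewrite -EFinD lte_fin; lra.
have Fny theta : (-oo < regularized theta)%E.
  by rewrite /regularized; case: (Lam theta) (Lam_ge0 theta) => [r| |]// _; rewrite ltNyr.
have K0 : K 0 by move=> i; rewrite /= mxE in_itv/= oppr_le0; lra.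
have [th Kth thmin] := lsc_compact_min regularized K lscF Fny cK (ex_intro _ _ K0).
exists th => th'; have [/thmin//|/uout u0] := pselect (K th').
apply: le_trans (thmin 0 K0) _.
by rewrite /regularized Lam0 /u !dotr0 mulr0 subr0 adde0 adde_ge0// lee_fin.
Qed.

Variable th : 'rV[R]_h.
Hypothesis th_min : forall theta, (regularized th <= regularized theta)%E.

Lemma minimizer_domain : D th.
Proof.
have := th_min 0; rewrite /regularized Lam0 /u !dotr0 mulr0 subr0 adde0.
by case E : (Lam th) (Lam_ge0 th) => [y| |]//= _ _; rewrite /D/effective_domain/= E ltry.
Qed.

Let Lf_min theta : D theta -> Lf th + u th <= Lf theta + u theta.
Proof.
move=> Dt; have := th_min theta.
by rewrite /regularized (LamE th minimizer_domain) (LamE theta Dt) -!EFinD lee_fin.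
Qed.

(* Along the segment from [th] to the interior point 0, minimality bounds the
   directional derivative and convexity then bounds the whole gradient, so [th]
   on the boundary would contradict steepness. *)
Lemma minimizer_interior : (interior D) th.
Proof.
apply: contrapT => nDth.
have Dth := minimizer_domain.
have [r r0 Hr] : exists2 r : R, 0 < r &
    forall y : 'rV[R]_h, (forall i, `|y 0 i - 0| < r) -> D y.
  have /nbhs_rVP[r r0 Hr] := Lam_int0; exists r => // y Hy; apply: Hr => i.
  by rewrite mxE.
pose s (n : nat) : R := n.+1%:R^-1.
have s0 n : 0 < s n by rewrite invr_gt0.
have s1 n : s n <= 1 by rewrite invf_le1// ler1n.
pose p n := (1 - s n) *: th.
have Dp n : (interior D) (p n) by apply: interior_segment => //; rewrite s0 s1.
have cp : p @ \oo --> th.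
  rewrite -[X in _ --> X]scale1r; apply: cvgZ; last exact: cvg_cst.
  rewrite -[X in _ --> X]subr0; apply: cvgB; first exact: cvg_cst.
  exact: cvg_harmonic.
have [_ _ _ /(_ p th Dp _ cp)] := Lam_smooth.
have bd : (closure (effective_domain Lam) `\` (interior (effective_domain Lam))) th.
  by split => //; exact: subset_closure.
move=> /(_ bd) /cvgryPgt steep.
pose r' := r / 2.
have r'0 : 0 < r' by exact: divr_gt0.
(* Testing the gradient inequality at these points on both sides of 0 bounds each coordinate of the
   gradient at [p n] uniformly in n. *)
pose z (i : 'I_h) (b : bool) : 'rV[R]_h := ((if b then 1 else -1) * r') *: delta_mx 0 i.
have Dz i b : D (z i b).
  apply: Hr => j; rewrite subr0 /z !mxE normrM (normrM _ r').
  have -> : `|if b then 1 else -1 : R| = 1 by case: b; rewrite ?normrN normr1.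
  rewrite mul1r (gtr0_norm r'0) /r'.
  by case: (_ && _); rewrite /= ?mulr1n ?mulr0n ?normr1 ?normr0; lra.
pose M := \sum_i (Lf (z i true) + Lf (z i false)).
have Lf_ge0 y : 0 <= Lf y by exact: fine_ge0.
have zM i b : Lf (z i b) <= M.
  rewrite /M (bigD1 i)//=; have := Lf_ge0 (z i true); have := Lf_ge0 (z i false).
  have : 0 <= \sum_(j < h | j != i) (Lf (z j true) + Lf (z j false)).
    by apply: sumr_ge0 => j _; exact: addr_ge0.
  by case: b; lra.
pose B := (M + `|dotr th x|) / r'.
have M0 : 0 <= M by apply: sumr_ge0 => j _; exact: addr_ge0.
have B0 : 0 <= B by rewrite divr_ge0 ?addr_ge0// ltW.
have [n _ /(_ n (leqnn n))] := steep (B + 1).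
rewrite /= ltNge => /negP; apply; apply: ltW; rewrite rV_norm_lt; last by lra.
apply/forallP => i; rewrite (@le_lt_trans _ _ B)//; last by lra.
set g := gradient Lam (p n).
(* The gradient inequality bounds [s n * dotr g th] by [Lf th - Lf (p n)], hence by [u (p n) - u th]
   by minimality; the quadratic part of this difference is nonpositive as [p n] is a contraction of
   [th]. *)
have gth : dotr g th <= dotr th x.
  have := gradient_inequality (p n) th (Dp n) Dth.
  have -> : th - p n = s n *: th by rewrite /p scalerBl scale1r opprB addrC subrK.
  rewrite -/g dotrZr => H1.
  have := Lf_min _ (interior_subset (Dp n)); rewrite /u /p !(dotrZl, dotrZr) -/(p n) => H2.
  have := dotr_ge0 th => S0; have := s0 n => s0'; have := s1 n => s1'.
  rewrite -(ler_pM2l s0').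
  have : 0 <= eps / 2 * ((2 - s n) * s n * dotr th th).
    by rewrite mulr_ge0 ?divr_ge0 ?(ltW eps0)// mulr_ge0// mulr_ge0 ?(ltW s0')//; lra.
  by nra.
have gp : dotr g (p n) <= `|dotr th x|.
  rewrite /p dotrZr; have := ler_norm (dotr th x); have := normr_ge0 (dotr th x).
  by have := s0 n; have := s1 n; nra.
have gz b : (if b then 1 else -1) * r' * g 0 i <= M + `|dotr th x|.
  have := gradient_inequality (p n) (z i b) (Dp n) (Dz i b).
  rewrite -/g -scaleN1r dotrDr !dotrZr [dotr g (delta_mx _ _)]dotrC dotr_delta.
  have := zM i b; have := Lf_ge0 (p n); set w := _ * g 0 i.
  by move: gp; rewrite /p dotrZr; lra.
rewrite /B ler_pdivlMr// -[X in _ * X <= _](gtr0_norm r'0) -normrM ler_norml.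
by have := gz true; have := gz false; rewrite mul1r => *; lra.
Qed.

(** The first-order condition at an interior minimum: [th] is compared with small steps of both
    signs along the axis, where the quadratic remainder is negligible. *)
Lemma minimizer_gradient i :
  is_derive th (delta_mx 0 i) (fine \o Lam) (x 0 i - eps * th 0 i).
Proof.
have Dth := minimizer_interior.
have := derive_gradient th (delta_mx 0 i) Dth.
set g := dotr _ _; suff -> : g = x 0 i - eps * th 0 i by [].
have := derive_gradient th (delta_mx 0 i) Dth; rewrite -/g => dg.
have uD s : u (s *: delta_mx 0 i + th) - u th =
    eps / 2 * (s ^+ 2 + 2 * s * th 0 i) - s * x 0 i.
  rewrite /u !(dotrDl, dotrDr, dotrZl, dotrZr) [dotr th (delta_mx _ _)]dotrC !dotr_delta.
  by rewrite mxE !eqxx/=; ring.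
have /nbhs_rVP[r1 r10 Hr1] := Dth.
have key e : 0 < e -> exists2 s, 0 < s & forall t, `|t| = s ->
    t * (x 0 i - eps * th 0 i) <= t * g + e * s.
  move=> e0; have e20 : 0 < e / 2 by exact: divr_gt0.
  have [r r0 Hr] := derivable_linearization _ _ _ _ _ dg e20.
  pose s := Num.min (r / 2) (Num.min (r1 / 2) (e / eps)).
  have sr : s <= r / 2 by rewrite ge_min lexx.
  have sr1 : s <= r1 / 2 by rewrite !ge_min lexx orbT.
  have se : s <= e / eps by rewrite !ge_min lexx !orbT.
  have s0 : 0 < s by rewrite !lt_min !divr_gt0.
  exists s => // t ts.
  have Dt : D (t *: delta_mx 0 i + th).
    apply: Hr1 => j; rewrite !mxE addrK normrM ts.
    by case: (_ && _); rewrite /= ?mulr1n ?mulr0n ?normr1 ?normr0; lra.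
  have tr : `|t| < r by rewrite ts; lra.
  have := Hr t tr; rewrite ts ler_norml => /andP[_].
  have := Lf_min _ Dt; have := uD t.
  rewrite /= -/(Lf _) -/(Lf th).
  have t2 : t ^+ 2 = s ^+ 2 by rewrite -ts real_normK ?num_real.
  have : eps * s ^+ 2 <= e * s.
    rewrite expr2 mulrA ler_pM2r// mulrC.
    by move: se; rewrite ler_pdivlMr.
  rewrite t2; nra.
apply/eqP; rewrite eq_le; apply/andP; split; apply/ler_addgt0Pr => e e0.
- have [s s0 /(_ (- s))] := key e e0; rewrite normrN gtr0_norm// => /(_ erefl).
  by move=> H; rewrite -(ler_pM2l s0); lra.
- have [s s0 /(_ s)] := key e e0; rewrite gtr0_norm// => /(_ erefl).
  by move=> H; rewrite -(ler_pM2l s0); lra.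
Qed.

(** The second bound compares [th] with the origin. It makes the displacement [eps *: th] small with
    [eps], as its squared Euclidean length is at most 2 eps v. *)
Lemma minimizer_value v : (forall theta, (dotr theta x)%:E - Lam theta <= v%:E)%E ->
  dotr th x - Lf th <= v /\ eps * dotr th th <= 2 * v.
Proof.
move=> /(_ th); rewrite (LamE th minimizer_domain) -EFinB lee_fin => H; split => //.
have D0 : D 0 by rewrite /D /effective_domain/= Lam0 ltry.
have := Lf_min 0 D0; rewrite /u !dotr0 /Lf Lam0/= => H2.
rewrite -/(Lf th) in H2; lra.
Qed.

End Minimizer.
End EssentiallySmoothConvex.

(** * The Gärtner-Ellis theorem *)

(** Every open set is a countable union of boxes with rational centre and radius 1/(n+1), and the
    preimage of a box is a finite intersection of coordinate events. *)
Lemma measurable_borel_rV {R : realType} {h : nat} {d} {T : measurableType d}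
    (Z : T -> 'rV[R]_h) :
  (forall i, measurable_fun setT (fun w => Z w 0 i)) ->
  measurable_fun setT (Z : T -> borel_rV).
Proof.
move=> mZ; apply: (@measurability _ _ T (g_sigma_algebraType (@open 'rV[R]_h)) setT Z (@open 'rV[R]_h)); first by [].
move=> _ [U oU <-]; rewrite setTI.
pose box (p : 'rV[rat]_h * nat) := [set y : 'rV[R]_h |
  forall i, `|y 0 i - ratr (p.1 0 i)| < p.2.+1%:R^-1].
pose B k : set T := if unpickle k is Some p then
  [set w | box p `<=` U] `&` (Z @^-1` box p) else set0.
rewrite (_ : _ @^-1` _ = \bigcup_k B k); last first.
  apply/seteqP; split => [w /= Uw|w [k _]]; last first.
    by rewrite /B; case: unpickle => // p [pU] /pU.
  have /nbhs_rVP[r r0 Hr] : nbhs (Z w) U by exact: open_nbhs_nbhs.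
  (* Two points of one box differ by less than 2/(n+1) in each coordinate, so that a box of this
     size containing [Z w] lies in [U]. *)
  pose n := Num.truncn (2 / r).
  have nr : 2 * n.+1%:R^-1 < r.
    have /andP[_] := truncn_itv (ltW (divr_gt0 (ltr0n R 2) r0)).
    by rewrite ltr_pdivrMr// ltr_pdivrMr ?ltr0n// mulrC.
  have n0 : 0 < n.+1%:R^-1 :> R by rewrite invr_gt0.
  have qP i : exists q : rat, `|Z w 0 i - ratr q| < n.+1%:R^-1.
    have [|q] := @rat_in_itvoo R (Z w 0 i - n.+1%:R^-1) (Z w 0 i + n.+1%:R^-1); first by rewrite ltrBlDr -addrA ltrDl addr_gt0.
    by rewrite in_itv/= => qi; exists q; rewrite ltr_distlC.
  pose q : 'rV[rat]_h := \row_i projT1 (cid (qP i)).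
  have Zq : box (q, n) (Z w) by move=> i; rewrite /= mxE; exact: projT2 (cid (qP i)).
  exists (pickle (q, n)) => //; rewrite /B pickleK; split => // y yq; apply: Hr => i.
  move: (Zq i) (yq i) nr => /=; set m := _^-1; set a := ratr _.
  by rewrite !ltr_norml => /andP[? ?] /andP[? ?] ?; apply/andP; split; lra.
apply: bigcupT_measurable => k; rewrite /B; case: unpickle => [p|]; last exact: measurable0.
have [pU|pU] := pselect (box p `<=` U); last first.
  by rewrite (_ : [set w | _] = set0) ?set0I//; apply/seteqP; split.
rewrite (_ : [set w | _] = setT) ?setTI; last by apply/seteqP; split.
rewrite (_ : _ @^-1` _ = \bigcap_(i in [set: 'I_h])
   (fun w => Z w 0 i) @^-1` `]ratr (p.1 0 i) - p.2.+1%:R^-1, ratr (p.1 0 i) + p.2.+1%:R^-1[).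
  apply: fin_bigcap_measurable => // i _.
  by rewrite -[_ @^-1` _]setTI; exact: mZ.
apply/seteqP; split => w /= H i; have := H i; rewrite /= in_itv/= ltr_distl.
  by [].
exact.
Qed.

Section LegendreRate.
Context {R : realType} {h : nat}.
Variable Lam : 'rV[R]_h -> \bar R.
Hypothesis Lam_ge0 : forall theta, (0 <= Lam theta)%E.
Hypothesis Lam0 : Lam 0 = 0%E.

Lemma legendre_gt x (a : R) : (a%:E < legendre_transform Lam x)%E ->
  exists theta y, Lam theta = y%:E /\ a + y < dotr theta x.
Proof.
move=> /ereal_sup_gt[_ [theta _ <-]].
case E : (Lam theta) (Lam_ge0 theta) => [y| |]//= _.
by rewrite -EFinB lte_fin => aL; exists theta, y; split => //; rewrite -ltrBrDr.
Qed.

Lemma legendre_rate_function : rate_function (legendre_transform Lam).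
Proof.
split=> [x|x a].
  apply: ereal_sup_ubound; exists 0 => //.
  by rewrite Lam0 sube0; congr (_%:E); exact: dotr0.
move=> /legendre_gt[theta [y [Ly ay]]].
exists [set x' | a + y < dotr theta x'].
  have /cvgr_gt := dotr_continuous theta x; exact.
move=> x' /= ax; apply: lt_le_trans (ereal_sup_ubound _); last by exists theta.
by rewrite Ly -EFinB lte_fin ltrBrDr.
Qed.

End LegendreRate.

Section GartnerEllis.
Context {R : realType} {h : nat} {d : measure_display} {T : measurableType d}.
Variables (P : probability T R) (Z : R -> T -> 'rV[R]_h) (Lam : 'rV[R]_h -> \bar R).
Hypothesis mZ : forall t, 0 < t -> forall i, measurable_fun setT (fun w => Z t w 0 i).
Hypothesis Lam_ge0 : forall theta, (0 <= Lam theta)%E.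
Hypothesis Lam0 : Lam 0 = 0%E.
Hypothesis Lam_convex : forall (s x y : R) a b, 0 <= s <= 1 ->
  (Lam a <= x%:E)%E -> (Lam b <= y%:E)%E ->
  (Lam (s *: a + (1 - s) *: b) <= (s * x + (1 - s) * y)%:E)%E.
Hypothesis Lam_smooth : essentially_smooth Lam.
Hypothesis Lam_lsc : lower_semicontinuous Lam.
Hypothesis Lam_int0 : (interior (effective_domain Lam)) 0.
Let mgf t theta := (\int[P]_w (expR (t * dotr theta (Z t w)))%:E)%E.
Hypothesis mgf_upper : forall theta y eta, Lam theta = y%:E -> 0 < eta ->
  exists2 C, 0 < C & \forall t \near +oo, (mgf t theta <= (C * expR ((y + eta) * t))%:E)%E.
Hypothesis mgf_lower : forall theta y eta, Lam theta = y%:E -> 0 < eta ->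
  exists2 C, 0 < C & \forall t \near +oo, ((C * expR ((y - eta) * t))%:E <= mgf t theta)%E.

Let I := legendre_transform Lam.

Let mZt t : 0 < t -> measurable_fun setT (Z t : T -> borel_rV).
Proof. by move=> t0; apply: measurable_borel_rV; exact: mZ. Qed.

Let measurable_open t (A : set 'rV[R]_h) : 0 < t -> open A -> measurable (Z t @^-1` A).
Proof.
move=> t0 oA; rewrite -[_ @^-1` _]setTI; apply: (mZt t t0) => //.
exact: sub_sigma_algebra.
Qed.

Let measurable_closed t (A : set 'rV[R]_h) : 0 < t -> closed A -> measurable (Z t @^-1` A).
Proof.
move=> t0 cA; rewrite -[A]setCK preimage_setC; apply: measurableC.
by apply: (measurable_open t (~` A) t0 (closed_openC cA)).
Qed.

Let mexp t theta b : 0 < t -> measurable_fun setT (fun w => expR (t * dotr theta (Z t w) + b)).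
Proof.
move=> t0; apply: measurableT_comp => //; apply: measurable_funD => //.
apply: measurable_funM => //; rewrite /dotr; apply: measurable_sum => i.
by apply: measurable_funM => //; exact: mZ.
Qed.

Let mgf_shift t theta b : 0 < t ->
  (\int[P]_w (expR (t * dotr theta (Z t w) + b))%:E = (expR b)%:E * mgf t theta)%E.
Proof.
move=> t0; under eq_integral => w _ do rewrite expRD mulrC EFinM.
rewrite ge0_integralZl//.
by apply/measurable_EFinP; have := mexp t theta 0 t0; under eq_fun do rewrite addr0.
Qed.

(* By Chernoff's bound the half-space [p.2 <= dotr p.1 x] then has probability
   exponentially smaller than [expR (- a * t)]. *)
Let beats (a : R) (p : 'rV[R]_h * R) := exists2 y, Lam p.1 = y%:E & a + y < p.2.

Let cover_bound (a : R) (n : nat) (p : 'I_n -> 'rV[R]_h * R) (A : set 'rV[R]_h) :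
  (forall j, beats a (p j)) -> closed A ->
  (forall x, A x -> exists j, (p j).2 <= dotr (p j).1 x) ->
  \forall t \near +oo, (P (Z t @^-1` A) <= (expR (- (a * t)))%:E)%E.
Proof.
move=> bp cA Ap.
have Vj : \forall t \near +oo, forall j : 'I_n,
    (\int[P]_w (expR (t * dotr (p j).1 (Z t w) + - (t * (p j).2)))%:E <=
      (n.+1%:R^-1 * expR (- (a * t)))%:E)%E.
  apply: filter_forall => j.
  (* Half of the slack: one half is spent on the error of the moment bound, the other leaves a
     factor [expR (- (e * t))] that absorbs the constants. *)
  have [y Ly ay] := bp j; pose e := ((p j).2 - a - y) / 2.
  have e0 : 0 < e by rewrite divr_gt0//; lra.
  have [C C0 HC] := mgf_upper _ _ _ Ly e0.
  near=> t; have t0 : 0 < t by near: t; exact: nbhs_pinfty_gt.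
  rewrite mgf_shift//.
  apply: (@le_trans _ _ ((expR (- (t * (p j).2)))%:E * (C * expR ((y + e) * t))%:E)%E).
    by apply: lee_wpmul2l; [rewrite lee_fin expR_ge0|near: t].
  rewrite -EFinM lee_fin mulrCA -expRD.
  have -> : - (t * (p j).2) + (y + e) * t = - (e * t) + - (a * t) by rewrite /e; field.
  rewrite expRD mulrA ler_pM2r ?expR_gt0// -ler_pdivlMl//.
  by near: t; apply: near_expR_le => //; rewrite mulr_gt0 ?invr_gt0.
near=> t; have t0 : 0 < t by near: t; exact: nbhs_pinfty_gt.
have Vt : forall j : 'I_n,
    (\int[P]_w (expR (t * dotr (p j).1 (Z t w) + - (t * (p j).2)))%:E <=
      (n.+1%:R^-1 * expR (- (a * t)))%:E)%E.
  by near: t; exact: Vj.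
pose V j w := expR (t * dotr (p j).1 (Z t w) + - (t * (p j).2)).
have mA : measurable (Z t @^-1` A) by exact: measurable_closed.
(* With constant weight 1, [tilting] is the union bound for the Chernoff estimates. *)
have := tilting P (fun=> 1) V (~` (Z t @^-1` A)) 1 (@measurable_cst _ _ _ _ _ _).
move=> /(_ (fun j => mexp t (p j).1 _ t0) (measurableC mA)).
rewrite integral_cst//= [P [set: _]]probability_setT !mul1e => /(_ _ _ _ _ _) H.
have {}H : (1 <= P (~` (Z t @^-1` A)) + \sum_j \int[P]_w (V j w)%:E)%E.
  apply: H => //.
  - by move=> j w; exact: expR_ge0.
  - move=> w /contrapT /Ap[j pj]; exists j.
    by rewrite -expR0 ler_expR -mulrBr mulr_ge0 ?subr_ge0// ltW.
rewrite probability_setC// in H.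
have HV : (\sum_j \int[P]_w (V j w)%:E <= (expR (- (a * t)))%:E)%E.
  apply: (@le_trans _ _ (\sum_(j < n) (n.+1%:R^-1 * expR (- (a * t)))%:E)%E).
    by apply: lee_sum => j _; exact: Vt.
  rewrite sumEFin lee_fin sumr_const card_ord -mulrnAl ler_piMl ?expR_ge0//.
  by rewrite -mulr_natl ler_pdivrMr ?ltr0n// mul1r ler_nat.
have := fin_num_measure P _ mA => PA.
rewrite -(fineK PA) in H *.
have {}H := le_trans H (leeD2l _ HV).
by move: H; rewrite -EFinB -EFinD !lee_fin; lra.
Unshelve. all: by end_near. Qed.

(** Finitely many half-spaces that beat [a] cover the set: inside a cube by compactness, outside it
    by half-spaces orthogonal to the axes. The latter exist because [Lam] is finite near 0, and they
    stand for exponential tightness. *)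
Lemma ldp_upper_exp (A : set 'rV[R]_h) (a : R) : closed A ->
  (forall x, A x -> (a%:E < I x)%E) ->
  \forall t \near +oo, (P (Z t @^-1` A) <= (expR (- (a * t)))%:E)%E.
Proof.
move=> cA aI.
have [r r0 Hr] : exists2 r : R, 0 < r &
    forall y : 'rV[R]_h, (forall i, `|y 0 i - 0| < r) -> effective_domain Lam y.
  have /nbhs_rVP[r r0 Hr] := Lam_int0; exists r => // y Hy; apply: Hr => i.
  by rewrite mxE.
pose z (i : 'I_h) (b : bool) : 'rV[R]_h := ((if b then 1 else -1) * (r / 2)) *: delta_mx 0 i.
have r20 : 0 < r / 2 by exact: divr_gt0.
have Dz i b : Lam (z i b) = (fine (Lam (z i b)))%:E.
  rewrite fineK// ge0_fin_numE//; apply: Hr => j.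
  rewrite subr0 /z !mxE normrM (normrM _ (r / 2)).
  have -> : `|if b then 1 else -1 : R| = 1 by case: b; rewrite ?normrN normr1.
  rewrite mul1r (gtr0_norm r20).
  by case: (_ && _); rewrite /= ?mulr1n ?mulr0n ?normr1 ?normr0; lra.
pose N := \sum_i (fine (Lam (z i true)) + fine (Lam (z i false))).
have f0 y : 0 <= fine (Lam y) by exact: fine_ge0.
have zN i b : fine (Lam (z i b)) <= N.
  rewrite /N (bigD1 i)//=; have := f0 (z i true); have := f0 (z i false).
  have : 0 <= \sum_(j < h | j != i) (fine (Lam (z j true)) + fine (Lam (z j false))).
    by apply: sumr_ge0 => j _; exact: addr_ge0.
  by case: b; lra.
pose M := (`|a| + N + 1) / (r / 2).
pose K := [set x : 'rV[R]_h | forall i, `[- M, M]%classic (x ord0 i)].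
have cK : compact (A `&` K).
  rewrite setIC; apply: compact_closedI => //.
  by apply: (@rV_compact _ _ (fun=> `[- M, M]%classic)) => _; exact: segment_compact.
move: (cK); rewrite compact_cover => /(_ _ [set p | beats a p]
  (fun p => [set x | p.2 < dotr p.1 x])) [||D Db DA].
- move=> p _; rewrite (_ : [set _ | _] = dotr p.1 @^-1` [set y | p.2 < y])//.
  by apply: open_comp; [move=> x _; exact: dotr_continuous|exact: open_gt].
- move=> x [/aI /(legendre_gt _ Lam_ge0)[theta [y [Ly ay]]] _].
  (* The midpoint leaves both strict inequalities: the half-space beats [a] and its open version
     contains x. *)
  exists (theta, (a + y + dotr theta x) / 2) => /=; last by lra.
  by exists y => //=; lra.
pose s := finmap.enum_fset D.
pose box := [seq (z p.1 p.2, a + N + 1) | p <- enum ([set: 'I_h * bool])%SET].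
pose full := box ++ s.
have bfull p : p \in full -> beats a p.
  rewrite mem_cat => /orP[/mapP[[i b] _ ->]|/Db/set_mem//].
  by exists (fine (Lam (z i b))); [exact: Dz|rewrite /=; have := zN i b; lra].
apply: (@cover_bound a (size full) (fun j => nth (0, 0) full j)) => //.
  by move=> j; apply: bfull; exact: mem_nth.
move=> x Ax.
suff [p pfull px] : exists2 p, p \in full & p.2 <= dotr p.1 x.
  have pj : (index p full < size full)%N by rewrite index_mem.
  by exists (Ordinal pj); rewrite /= nth_index.
have [Kx|/existsNP[i nKx]] := pselect (K x).
  have [p /= Dp px] := DA x (conj Ax Kx).
  by exists p; [rewrite mem_cat; apply/orP; right|exact: ltW].
have : M < `|x 0 i| by move: nKx; rewrite /= in_itv/= -ler_norml => /negP; rewrite -ltNge.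
rewrite /M ltr_pdivrMr// => Mx.
exists (z i (0 <= x 0 i), a + N + 1).
  rewrite mem_cat; apply/orP; left; apply/mapP; exists (i, 0 <= x 0 i) => //.
  by rewrite mem_enum inE.
rewrite /= /z dotrZl dotr_delta; have := ler_norm a.
by move: Mx; case: (leP 0 (x 0 i)) => x0; [rewrite (ger0_norm x0)|rewrite (ltr0_norm x0)]; lra.
Qed.

(** The weight with parameter [th] concentrates on a box around the exposed point [y], since leaving
    the box in a direction [j] is controlled by the moment at [th] shifted along [j]. Inside the box
    the weight is almost constant, which converts the remaining mass into a probability. *)
Lemma ldp_lower_exp (A : set 'rV[R]_h) (x : 'rV[R]_h) (a : R) : open A -> A x ->
  (I x < a%:E)%E -> \forall t \near +oo, ((expR (- (a * t)))%:E <= P (Z t @^-1` A))%E.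
Proof.
move=> oA Ax Ixa.
have [v Iv va] : exists2 v, (I x = v%:E)%E & v < a.
  have := (legendre_rate_function _ Lam_ge0 Lam0).1 x; move: Ixa; rewrite -/I.
  by case: (I x) => [v| |]//; rewrite lte_fin; exists v.
have v0 : 0 <= v.
  by have := (legendre_rate_function _ Lam_ge0 Lam0).1 x; rewrite -/I Iv lee_fin.
have /nbhs_rVP[rho rho0 Hrho] : nbhs x A by exact: open_nbhs_nbhs.
(* Each coordinate of [eps *: th] then has square at most 2 eps v < (rho/2)^2, so [y] is within
   rho/2 of x. *)
pose eps := rho ^+ 2 / (8 * (v + 1)).
have v8 : 0 < 8 * (v + 1) by rewrite mulr_gt0//; lra.
have eps0 : 0 < eps by rewrite divr_gt0 ?exprn_gt0.
have epsv : 2 * eps * v < (rho / 2) ^+ 2.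
  have : eps * (8 * (v + 1)) = rho ^+ 2 by rewrite /eps divfK ?gt_eqF.
  by have := exprn_gt0 2 rho0; nra.
have [th thmin] := regularized_minimizer Lam Lam_ge0 Lam0 Lam_lsc eps x eps0.
have thI := minimizer_interior Lam Lam_ge0 Lam0 Lam_convex Lam_smooth Lam_int0 eps x eps0 th thmin.
have thG := minimizer_gradient Lam Lam_ge0 Lam0 Lam_convex Lam_smooth Lam_int0 eps x eps0 th thmin.
pose lam := fine (Lam th).
have [thv thS] : dotr th x - lam <= v /\ eps * dotr th th <= 2 * v.
  apply: (minimizer_value Lam Lam_ge0 Lam0 eps x th thmin) => theta.
  by rewrite -Iv; apply: ereal_sup_ubound; exists theta.
have thD : Lam th = lam%:E.
  rewrite /lam fineK// ge0_fin_numE//; exact: (minimizer_domain Lam Lam_ge0 Lam0 eps x th thmin).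
pose y : 'rV[R]_h := x - eps *: th.
have yE i : y 0 i = x 0 i - eps * th 0 i by rewrite !mxE.
have yx i : `|y 0 i - x 0 i| < rho / 2.
  rewrite yE addrAC subrr sub0r normrN -(@ltr_pXn2r _ 2) ?nnegrE ?normr_ge0 ?divr_ge0 ?(ltW rho0)//.
  rewrite real_normK ?num_real// exprMn; have := dotr_ge_sqr i th.
  by move: epsv thS eps0; nra.
pose B := \sum_i `|th 0 i|.
have B0 : 0 <= B by exact: sumr_ge0.
(* The first bound keeps the box inside [A]. The second limits the losses to half of a - v:
   [del * B] from the variation of the weight on the box, and one more [del] for [eta], which is
   smaller since [r <= 1]. *)
pose del := Num.min (rho / 2) ((a - v) / (2 * (B + 1))).
have del0 : 0 < del by rewrite lt_min !divr_gt0// ?subr_gt0// mulr_gt0//; lra.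
have del1 : del <= rho / 2 by rewrite ge_min lexx.
have del2 : del * (B + 1) <= (a - v) / 2.
  have : del <= (a - v) / (2 * (B + 1)) by rewrite ge_min lexx orbT.
  by rewrite invfM mulrA ler_pdivlMr//; lra.
pose sg (b : bool) : R := if b then 1 else -1.
have [r [r0 r1 Hr]] : exists r : R, [/\ 0 < r, r <= 1 & forall (i : 'I_h) b,
    (Lam ((sg b * r) *: delta_mx 0 i + th)%R <=
      (lam + sg b * r * y 0 i + r * (del / 4))%:E)%E].
  have de4 : 0 < del / 4 by exact: divr_gt0.
  have /nbhs_rVP[r1 r10 Hr1] := thI.
  have H (i : 'I_h) b : \forall r \near (0 : R)^'+,
      (Lam ((sg b * r) *: delta_mx 0 i + th)%R <=
        (lam + sg b * r * y 0 i + r * (del / 4))%:E)%E.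
    have [r r0 Hr] := derivable_linearization _ _ _ _ _ (thG i) de4.
    near=> s.
    have s0 : 0 < s by near: s; exact: nbhs_right_gt.
    have sr : s < r by near: s; exact: nbhs_right_lt.
    have sr1 : s < r1 by near: s; exact: nbhs_right_lt.
    have sgs : `|sg b * s| = s.
      by rewrite normrM (gtr0_norm s0) /sg; case: b; rewrite ?normrN normr1 mul1r.
    have := Hr (sg b * s); rewrite sgs => /(_ sr).
    rewrite ler_norml => /andP[_] /=; rewrite -yE -/lam => Hs.
    have Ds : effective_domain Lam ((sg b * s) *: delta_mx 0 i + th).
      apply: Hr1 => j; rewrite !mxE addrK normrM sgs.
      by case: (_ && _); rewrite /= ?mulr1n ?mulr0n ?normr1 ?normr0; lra.
    rewrite -[leLHS]fineK; last by rewrite ge0_fin_numE.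
    by rewrite lee_fin; lra.
  have : \forall r \near (0 : R)^'+, 0 < r /\ r <= 1 /\ forall (i : 'I_h) b,
      (Lam ((sg b * r) *: delta_mx 0 i + th)%R <=
        (lam + sg b * r * y 0 i + r * (del / 4))%:E)%E.
    near=> r; split; first by near: r; exact: nbhs_right_gt.
    split; first by near: r; exact: nbhs_right_le.
    by near: r; do 2! apply: filter_forall => ?; exact: H.
  by move=> /filter_ex[r [? [? ?]]]; exists r.
pose eta := r * (del / 4).
have eta0 : 0 < eta by rewrite mulr_gt0// divr_gt0.
pose J : finType := ('I_h * bool)%type.
pose q (j : J) := (sg j.2 * r) *: delta_mx 0 j.1 + th.
(* This offset costs 4 eta beyond the linear term in [y]. Linearisation and the moment bound give
   back one [eta] each, so the rate is at most lam - 2 eta, smaller than the rate lam - eta of the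
   weight itself. *)
pose bj (j : J) t := - (t * (r * (sg j.2 * y 0 j.1 + del))).
have [c c0 Hc] := mgf_lower _ _ _ thD eta0.
have Vj : \forall t \near +oo, forall j : J,
    (\int[P]_w (expR (t * dotr (q j) (Z t w) + bj j t))%:E <=
      (c / (2 * #|J|.+1%:R) * expR ((lam - eta) * t))%:E)%E.
  apply: filter_forall => j.
  have qle := Hr j.1 j.2; rewrite -/(q j) in qle.
  have Ly : Lam (q j) = (fine (Lam (q j)))%:E.
    by rewrite fineK// ge0_fin_numE//; apply: le_lt_trans qle _; exact: ltry.
  have [C C0 HC] := mgf_upper _ _ _ Ly eta0.
  rewrite Ly lee_fin in qle.
  near=> t; have t0 : 0 < t by near: t; exact: nbhs_pinfty_gt.
  rewrite mgf_shift//.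
  apply: (@le_trans _ _ ((expR (bj j t))%:E * (C * expR ((fine (Lam (q j)) + eta) * t))%:E)%E).
    by apply: lee_wpmul2l; [rewrite lee_fin expR_ge0|near: t].
  rewrite -EFinM lee_fin mulrCA -expRD.
  apply: (@le_trans _ _ (C * (expR (- (eta * t)) * expR ((lam - eta) * t)))).
    rewrite ler_pM2l// -expRD ler_expR /bj.
    have := ler_wpM2r (ltW t0) qle; rewrite /eta; lra.
  rewrite mulrA ler_pM2r ?expR_gt0// -ler_pdivlMl//.
  by near: t; apply: near_expR_le => //; rewrite mulr_gt0 ?invr_gt0 ?divr_gt0 ?mulr_gt0.
near=> t; have t0 : 0 < t by near: t; exact: nbhs_pinfty_gt.
have Vt : forall j : J, (\int[P]_w (expR (t * dotr (q j) (Z t w) + bj j t))%:E <=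
      (c / (2 * #|J|.+1%:R) * expR ((lam - eta) * t))%:E)%E.
  by near: t; exact: Vj.
have Wt : ((c * expR ((lam - eta) * t))%:E <= mgf t th)%E by near: t.
have ct : expR (- ((a - v) / 2 * t)) <= c / 2.
  by near: t; apply: near_expR_le; rewrite divr_gt0// subr_gt0.
pose box := [set z : 'rV[R]_h | forall i, `|z 0 i - y 0 i| < del].
have obox : open box.
  rewrite openE => z bz; apply/nbhs_rVP.
  have H : \forall e \near (0 : R)^'+, 0 < e /\ forall i, `|z 0 i - y 0 i| + e <= del.
    near=> e; split; first by near: e; exact: nbhs_right_gt.
    near: e; apply: filter_forall => i; near=> e.
    rewrite -lerBrDl; near: e; apply: nbhs_right_le; rewrite subr_gt0; exact: bz.
  have /filter_ex[e [e0 He]] := H; exists e => // z' Hz' i.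
  apply: lt_le_trans (He i); have := ler_normD (z' 0 i - z 0 i) (z 0 i - y 0 i).
  by rewrite addrA subrK; have := Hz' i; lra.
have mG : measurable (Z t @^-1` box) by exact: measurable_open.
have boxA : box `<=` A.
  move=> z bz; apply: Hrho => i; have := bz i; have := yx i.
  have := ler_normD (z 0 i - y 0 i) (y 0 i - x 0 i); rewrite addrA subrK; lra.
apply: (@le_trans _ _ (P (Z t @^-1` box))); last first.
  apply: le_measure; rewrite ?inE//; first exact: measurable_open.
  by move=> w /boxA.
have T1 : (mgf t th <= (expR (t * (dotr th y + del * B)))%:E * P (Z t @^-1` box) +
    \sum_(j : J) \int[P]_w (expR (t * dotr (q j) (Z t w) + bj j t))%:E)%E.
  apply: (tilting P (fun w => expR (t * dotr th (Z t w)))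
    (fun (j : J) w => expR (t * dotr (q j) (Z t w) + bj j t))) => //.
  - by have := mexp t th 0 t0; under eq_fun do rewrite addr0.
  - by move=> j; exact: mexp.
  - move=> w bw; rewrite ler_expR ler_pM2l//.
    rewrite -[Z t w](subrK y) addrC dotrDr lerD2l /B mulr_sumr.
    apply: ler_sum => i _; rewrite (le_trans (ler_norm _))// normrM mulrC ler_wpM2r//.
    by rewrite !mxE -yE; apply: ltW; have := bw i.
  - move=> w /existsNP[i /negP]; rewrite -leNgt => Zi.
    exists (i, 0 <= Z t w 0 i - y 0 i); rewrite ler_expR /bj -mulrBr ler_pM2l//.
    rewrite /q/= dotrDl dotrZl dotr_delta /sg; move: Zi.
    case: (leP 0 (Z t w 0 i - y 0 i)) => Zy.
      by rewrite (ger0_norm Zy); nra.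
    by rewrite (ltr0_norm Zy); nra.
have PG := fin_num_measure P _ mG.
have {T1} T1 : c / 2 * expR ((lam - eta) * t) <=
    expR (t * (dotr th y + del * B)) * fine (P (Z t @^-1` box)).
  have Vs : (\sum_(j : J) \int[P]_w (expR (t * dotr (q j) (Z t w) + bj j t))%:E <=
      (c / 2 * expR ((lam - eta) * t))%:E)%E.
    apply: (@le_trans _ _ (\sum_(j : J) (c / (2 * #|J|.+1%:R) * expR ((lam - eta) * t))%:E)%E).
      by apply: lee_sum => j _; exact: Vt.
    rewrite sumEFin lee_fin sumr_const -mulrnAl ler_pM2r ?expR_gt0//.
    have -> : (c / (2 * #|J|.+1%:R)) *+ #|J| = c / 2 * (#|J|%:R / #|J|.+1%:R).
      by rewrite -mulr_natl invfM; ring.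
    rewrite ler_piMr ?divr_ge0 ?(ltW c0)//.
    by rewrite ler_pdivrMr ?ltr0n// mul1r ler_nat.
  have := le_trans Wt (le_trans T1 (leeD2l _ Vs)).
  by rewrite -(fineK PG) -EFinM -EFinD lee_fin /=; lra.
rewrite -(fineK PG) lee_fin.
have E0 := expR_gt0 (t * (dotr th y + del * B)).
rewrite -(ler_pM2l E0); apply: le_trans T1.
apply: (@le_trans _ _ (expR (- ((a - v) / 2 * t)) * expR ((lam - eta) * t))); last first.
  by rewrite ler_pM2r ?expR_gt0.
rewrite -!expRD ler_expR.
have yv : dotr th y - lam <= v.
  rewrite /y -scaleNr dotrDr dotrZr; have := dotr_ge0 th; nra.
have : eta <= del by rewrite /eta; nra.
by nra.
Unshelve. all: by end_near. Qed.

Let le_ereal_real (x y : \bar R) : (forall a : R, (a%:E < x)%E -> (a%:E <= y)%E) -> (x <= y)%E.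
Proof.
move=> H; rewrite leNgt; apply/negP => yx.
have [r yr rx] : exists2 r : R, (y < r%:E)%E & (r%:E < x)%E.
  move: yx; case: x H => [x| |] _; case: y => [y| |]//=.
  - by rewrite !lte_fin => yx; exists ((x + y) / 2); rewrite lte_fin; lra.
  - by move=> _; exists (x - 1); rewrite ?ltNyr// lte_fin; lra.
  - by move=> _; exists (y + 1); rewrite ?ltry// lte_fin; lra.
  - by move=> _; exists 0; rewrite ?ltNyr ?ltry.
by have := lt_le_trans yr (H r rx); rewrite ltxx.
Qed.

Let lne_exp (t a : R) : 0 < t ->
  (- a)%:E = ((t^-1)%:E * lne (expR (- (a * t)))%:E)%E.
Proof.
move=> t0; rewrite lne_EFin ?expR_gt0// expRK -EFinM.
by rewrite mulrN mulrC mulfK ?gt_eqF.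
Qed.

Let nonneg_itv (p : \bar R) : (0 <= p)%E -> p \in `[0%E, +oo%E].
Proof. by move=> p0; rewrite in_itv/= p0 leey. Qed.

Let lne_scale_le (t : R) (p q : \bar R) : 0 < t -> (0 <= p)%E -> (p <= q)%E ->
  ((t^-1)%:E * lne p <= (t^-1)%:E * lne q)%E.
Proof.
move=> t0 p0 pq; apply: lee_wpmul2l; first by rewrite lee_fin invr_ge0 ltW.
by rewrite lee_lne// nonneg_itv// (le_trans p0).
Qed.

(** Both bounds are tested against real levels [a]: the exponential estimates hold for each [a]
    strictly on the right side of the rate, which also covers infinite infima and null
    probabilities. *)
Theorem gartner_ellis : large_deviation_principle P Z (fun t => t) (legendre_transform Lam).
Proof.
split.
- exact: mZt.
- exact: cvg_id.
- exact: legendre_rate_function.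
- move=> C cC; rewrite leeNr; apply: le_ereal_real => a aI; rewrite leeNr -EFinN.
  have H : \forall t \near +oo, (((t^-1)%:E * lne (P (Z t @^-1` C)))%E <= (- a)%:E)%E.
    near=> t; have t0 : 0 < t by near: t; exact: nbhs_pinfty_gt.
    rewrite (lne_exp t a t0); apply: lne_scale_le => //; near: t; apply: ldp_upper_exp => // x Cx.
    by apply: lt_le_trans aI _; apply: ereal_inf_lbound; exists x.
  pose U := [set t | ((t^-1)%:E * lne (P (Z t @^-1` C)) <= (- a)%:E)%E].
  apply: (@le_trans _ _ (ereal_sup ((fun t => (t^-1)%:E * lne (P (Z t @^-1` C)))%E @` U))).
    by apply: ereal_inf_lbound; exists U; [exact: H|].
  by apply: ge_ereal_sup => _ [t Ht <-].
- move=> C oC; rewrite leeNl; apply/ereal_infP => _ [x Cx <-].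
  rewrite leeNl; apply: le_ereal_real => a aI.
  have H : \forall t \near +oo, (a%:E <= (t^-1)%:E * lne (P (Z t @^-1` C)))%E.
    near=> t; have t0 : 0 < t by near: t; exact: nbhs_pinfty_gt.
    rewrite -[a]opprK (lne_exp t _ t0); apply: lne_scale_le => //.
    near: t.
    by apply: (ldp_lower_exp _ x) => //; rewrite EFinN lteNr.
  pose U := [set t | (a%:E <= (t^-1)%:E * lne (P (Z t @^-1` C)))%E].
  rewrite limf_einfE.
  apply: (@le_trans _ _ (ereal_inf ((fun t => (t^-1)%:E * lne (P (Z t @^-1` C)))%E @` U))).
    by apply/ereal_infP => _ [t Ut <-].
  by apply: ereal_sup_ubound; exists U; [exact: H|].
Unshelve. all: by end_near. Qed.

End GartnerEllis.

(** * The time-changed process *)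

Section LogMgf.
Context {R : realType} {d : measure_display} {T : measurableType d}.
Variables (P : probability T R) (Y : T -> R).
Hypothesis mY : measurable_fun setT Y.

Let mgf theta := (\int[P]_w (expR (theta * Y w))%:E)%E.

Lemma log_mgfE theta : log_mgf P Y theta = lne (mgf theta).
Proof.
rewrite /log_mgf /mmt_gen_fun unlock; congr lne; apply: eq_integral => w _ /=.
by rewrite mulrC.
Qed.

Let mexp theta : measurable_fun setT (fun w => (expR (theta * Y w))%:E).
Proof.
apply/measurable_EFinP; apply: measurableT_comp => //; exact: measurable_funM.
Qed.

Let mgf_gt0 theta : (0 < mgf theta)%E.
Proof.
rewrite lt_neqAle eq_sym integral_ge0 ?andbT; last by move=> w _; rewrite lee_fin expR_ge0.
apply/eqP => M0.
have /(ae_eq_integral_abs P measurableT (mexp theta)) [N [mN N0 sN]] :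
    (\int[P]_(w in setT) `|(expR (theta * Y w))%:E| = 0)%E.
  by rewrite -M0; apply: eq_integral => w _; rewrite gee0_abs// lee_fin expR_ge0.
have NT : N = setT.
  apply/seteqP; split => // w _; apply: sN => /= /(_ I) [E].
  by have := expR_gt0 (theta * Y w); rewrite E ltxx.
have := probability_setT P; rewrite -NT => NN.
by move: N0; rewrite [X in X = _ -> _]NN => -[/eqP]; rewrite oner_eq0.
Qed.

Lemma log_mgf_gtNy theta : (-oo < log_mgf P Y theta)%E.
Proof.
rewrite log_mgfE; have := mgf_gt0 theta.
case: (mgf theta) => [r| |]//.
by rewrite lte_fin => r0; rewrite lne_EFin// ltNyr.
Qed.

Lemma log_mgf_fin theta k : log_mgf P Y theta = k%:E -> mgf theta = (expR k)%:E.
Proof.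
rewrite log_mgfE; have := mgf_gt0 theta.
case: (mgf theta) => [r| |]//; rewrite lte_fin => r0.
by rewrite lne_EFin// => -[<-]; rewrite lnK.
Qed.

Lemma log_mgf0 : log_mgf P Y 0 = 0%E.
Proof.
rewrite log_mgfE /mgf; under eq_integral do rewrite mul0r expR0.
by rewrite integral_cst//= mul1e [P _]probability_setT lne1.
Qed.

(** Hölder's inequality in normalised form: [expR (a * Y - ka)] and [expR (b * Y - kb)] have
    integral 1, and convexity of the exponential, obtained from its tangent at the weighted mean, is
    integrated. *)
Lemma log_mgf_convex s a b ka kb : 0 <= s <= 1 ->
  log_mgf P Y a = ka%:E -> log_mgf P Y b = kb%:E ->
  (log_mgf P Y (s * a + (1 - s) * b) <= (s * ka + (1 - s) * kb)%:E)%E.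
Proof.
move=> /andP[s0 s1] /log_mgf_fin Ma /log_mgf_fin Mb.
set k := s * ka + _.
have k0 : (0 <= (expR k)%:E)%E by rewrite lee_fin expR_ge0.
suff : (mgf (s * a + (1 - s) * b) <= (expR k)%:E)%E.
  have i0 (p : \bar R) : (0 <= p)%E -> p \in `[0%E, +oo%E].
    by move=> p0; rewrite in_itv/= p0 leey.
  move=> Mle; rewrite log_mgfE.
  have -> : k%:E = lne (expR k)%:E by rewrite lne_EFin ?expR_gt0// expRK.
  by rewrite lee_lne ?i0 ?(ltW (mgf_gt0 _)).
have mg c e f : measurable_fun setT (fun w => (c * expR (f * Y w - e))%:E).
  apply/measurable_EFinP; apply: measurable_funM => //; apply: measurableT_comp => //.
  by apply: measurable_funB => //; exact: measurable_funM.
have I1 c e f : 0 <= c -> mgf f = (expR e)%:E ->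
    (\int[P]_w (c * expR (f * Y w - e))%:E)%E = c%:E.
  move=> c0 Mf; under eq_integral => w _ do rewrite mulrC expRD expRN -mulrA mulrC EFinM.
  rewrite ge0_integralZl//.
  - by rewrite -/(mgf f) Mf -EFinM mulrAC mulVf ?mul1r// gt_eqF ?expR_gt0.
  - by rewrite lee_fin mulr_ge0// invr_ge0 expR_ge0.
apply: (@le_trans _ _ (\int[P]_w ((expR k)%:E * ((s * expR (a * Y w - ka))%:E +
   ((1 - s) * expR (b * Y w - kb))%:E)))%E).
  apply: ge0_le_integral => //.
  - by apply: measurable_funeM; exact: emeasurable_funD.
  move=> w _; rewrite -EFinD -EFinM lee_fin.
  rewrite -ler_pdivrMl ?expR_gt0// -expRN -expRD.
  set u := a * Y w - ka; set v := b * Y w - kb.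
  have -> : - k + (s * a + (1 - s) * b) * Y w = s * u + (1 - s) * v.
    by rewrite /k /u /v; ring.
  set m := s * u + (1 - s) * v.
  have tangent x : expR m * (1 + (x - m)) <= expR x.
    have -> : expR x = expR m * expR (x - m) by rewrite -expRD addrC subrK.
    by rewrite ler_wpM2l ?expR_ge0// expR_ge1Dx.
  have s1' : 0 <= 1 - s by lra.
  have := ler_wpM2l s0 (tangent u); have := ler_wpM2l s1' (tangent v).
  have : expR m * (s * u + (1 - s) * v - m) = 0 by rewrite subrr mulr0.
  by nra.
rewrite ge0_integralZl//; last 2 first.
- exact: emeasurable_funD.
- by move=> w _; rewrite adde_ge0// lee_fin mulr_ge0 ?expR_ge0//; lra.
rewrite ge0_integralD//; last 2 first.
- by move=> w _; rewrite lee_fin mulr_ge0 ?expR_ge0//; lra.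
- by move=> w _; rewrite lee_fin mulr_ge0 ?expR_ge0//; lra.
by rewrite !I1//; [rewrite -EFinD -EFinM addrC subrK mulr1|lra].
Qed.

End LogMgf.

Section MittagLefflerRate.
Context {R : realType}.
Variable nu : R.
Hypothesis nu01 : 0 < nu < 1.

Let rateE xi : mittag_leffler_rate nu xi = (Num.max xi 0) `^ nu^-1.
Proof.
have /andP[nu0 _] := nu01.
rewrite /mittag_leffler_rate; have [xi0|xi0] := leP 0 xi; first by [].
by rewrite powR0// invr_eq0 gt_eqF.
Qed.

Lemma mittag_leffler_rate_le : {homo mittag_leffler_rate nu : x y / x <= y}.
Proof.
have /andP[nu0 _] := nu01.
move=> x y xy; rewrite !rateE.
have m0 (z : R) : Num.max z 0 \is Num.nneg by rewrite nnegrE le_max lexx orbT.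
apply: ge0_ler_powR => //; first by rewrite invr_ge0 ltW.
by rewrite ge_max !le_max xy lexx orbT.
Qed.

(** Passing to positive parts can only raise the left side and does not change the right one; on
    nonnegative reals the power 1/nu >= 1 is convex. *)
Lemma mittag_leffler_rate_convex s x y : 0 <= s <= 1 ->
  mittag_leffler_rate nu (s * x + (1 - s) * y) <=
  s * mittag_leffler_rate nu x + (1 - s) * mittag_leffler_rate nu y.
Proof.
have /andP[nu0 nu1] := nu01.
move=> /andP[s0 s1]; have s1' : 0 <= 1 - s by lra.
set x' := Num.max x 0; set y' := Num.max y 0.
have x'0 : 0 <= x' by rewrite le_max lexx orbT.
have y'0 : 0 <= y' by rewrite le_max lexx orbT.
have xx' : x <= x' by rewrite le_max lexx.
have yy' : y <= y' by rewrite le_max lexx.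
apply: (@le_trans _ _ (mittag_leffler_rate nu (s * x' + (1 - s) * y'))).
  by apply: mittag_leffler_rate_le; rewrite lerD// ler_wpM2l.
have z0 : 0 <= s * x' + (1 - s) * y' by rewrite addr_ge0// mulr_ge0.
rewrite !rateE -/x' -/y' (max_idPl z0).
have p1 : 1 <= nu^-1 by rewrite invf_ge1// ltW.
have := @convex_powR R _ p1 (@Itv01 R s s0 s1) x' y'.
rewrite !inE/= !in_itv/= !andbT => /(_ x'0 y'0).
by rewrite !convRE.
Qed.

End MittagLefflerRate.

Section PsiProperties.
Context {R : realType} {h : nat}.
Variables (kappa : 'I_h -> R -> \bar R) (c nu : 'I_h.+1 -> R).
Hypothesis c_gt0 : forall i, 0 < c i.
Hypothesis nu_in01 : forall i, 0 < nu i < 1.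
Hypothesis kappa_gtNy : forall i theta, (-oo < kappa i theta)%E.

Definition clock_exponent (k : 'I_h -> R) (j : 'I_h.+1) : R :=
  c j * (if unlift ord0 j is Some i then k i else \sum_i k i).

Lemma Psi_EFin (k : 'I_h -> R) (theta : 'rV[R]_h) :
  (forall i, kappa i (theta 0 i) = (k i)%:E) ->
  Psi kappa c nu theta =
    (\sum_j mittag_leffler_rate (nu j) (clock_exponent k j))%:E.
Proof.
move=> kE; have cge j x : (0 <= c j * x) = (0 <= x) by rewrite pmulr_rge0.
rewrite big_ord_recl addrC EFinD /Psi -sumEFin; congr (_ + _)%E.
  apply: eq_bigr => i _; rewrite kE lee_fin /mittag_leffler_rate /clock_exponent liftK cge.
  by case: ifP => // _; rewrite -EFinM poweR_EFin.
under eq_bigr do rewrite kE.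
rewrite sumEFin lee_fin /mittag_leffler_rate /clock_exponent unlift_none cge.
by case: ifP => // _; rewrite -EFinM poweR_EFin.
Qed.

Let own_ge0 i theta : (0 <= if 0 <= kappa i theta then
  ((c (lift ord0 i))%:E * kappa i theta) `^ (nu (lift ord0 i))^-1 else 0)%E.
Proof. by case: ifP => // _; exact: poweR_ge0. Qed.

Lemma Psi_ge0 theta : (0 <= Psi kappa c nu theta)%E.
Proof.
rewrite /Psi adde_ge0//; first by apply: sume_ge0 => i _; exact: own_ge0.
by case: ifP => // _; exact: poweR_ge0.
Qed.

(** An infinite [kappa i] makes the term of the i-th own clock infinite, and no other term can
    compensate as all are nonnegative. So the finite formula for [Psi] holds on its whole domain. *)
Lemma Psi_lty_fin theta : (Psi kappa c nu theta < +oo)%E ->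
  exists k : 'I_h -> R, forall i, kappa i (theta 0 i) = (k i)%:E.
Proof.
move=> Py; exists (fun i => fine (kappa i (theta 0 i))) => i.
have := kappa_gtNy i (theta 0 i); case E : (kappa i (theta 0 i)) => [r| |]// _.
suff : Psi kappa c nu theta = +oo%E by move=> PE; move: Py; rewrite PE ltxx.
have /andP[nu0 _] := nu_in01 (lift ord0 i).
apply/eqP; rewrite -leye_eq /Psi (bigD1 i)//= E leey gt0_muley ?lte_fin//.
rewrite poweRyr ?invr_eq0 ?gt_eqF// -addeA leye_eq addye//.
rewrite gt_eqF// (@lt_le_trans _ _ 0%E)// ?ltNyr// adde_ge0//.
  by apply: sume_ge0 => j _; exact: own_ge0.
by case: ifP => // _; exact: poweR_ge0.
Qed.

Lemma Psi0 : (forall i, kappa i 0 = 0%E) -> Psi kappa c nu 0 = 0%E.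
Proof.
move=> k0; rewrite (Psi_EFin (fun=> 0)) => [|i]; last by rewrite mxE k0.
congr EFin; apply: big1 => j _; rewrite /clock_exponent.
have -> : (if unlift ord0 j is Some i then 0 else \sum_(i < h) 0) = 0 :> R.
  by case: unlift => //; rewrite big1.
have /andP[nu0 _] := nu_in01 j.
by rewrite mulr0 /mittag_leffler_rate lexx powR0// invr_eq0 gt_eqF.
Qed.

Lemma Psi_convex : (forall i s a b ka kb, 0 <= s <= 1 ->
    kappa i a = ka%:E -> kappa i b = kb%:E ->
    (kappa i (s * a + (1 - s) * b) <= (s * ka + (1 - s) * kb)%:E)%E) ->
  forall (s x y : R) (a b : 'rV[R]_h), 0 <= s <= 1 ->
  (Psi kappa c nu a <= x%:E)%E -> (Psi kappa c nu b <= y%:E)%E ->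
  (Psi kappa c nu (s *: a + (1 - s) *: b) <= (s * x + (1 - s) * y)%:E)%E.
Proof.
move=> kconv s x y a b s01 Pa Pb.
have [ka kaE] := Psi_lty_fin a (le_lt_trans Pa (ltry _)).
have [kb kbE] := Psi_lty_fin b (le_lt_trans Pb (ltry _)).
have kle i := kconv i s _ _ _ _ s01 (kaE i) (kbE i).
pose k i := fine (kappa i ((s *: a + (1 - s) *: b) 0 i)).
have kE i : kappa i ((s *: a + (1 - s) *: b) 0 i) = (k i)%:E.
  rewrite /k fineK// fin_numElt kappa_gtNy/= !mxE.
  by apply: le_lt_trans (kle i) _; exact: ltry.
have kk i : k i <= s * ka i + (1 - s) * kb i.
  by rewrite -lee_fin -kE !mxE.
move: Pa Pb; rewrite (Psi_EFin _ _ kaE) (Psi_EFin _ _ kbE) (Psi_EFin _ _ kE) !lee_fin => Pa Pb.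
have /andP[s0 s1] := s01; have s1' : 0 <= 1 - s by lra.
apply: (@le_trans _ _ (s * (\sum_j mittag_leffler_rate (nu j) (clock_exponent ka j)) +
    (1 - s) * (\sum_j mittag_leffler_rate (nu j) (clock_exponent kb j)))); last first.
  by rewrite lerD// ler_wpM2l.
rewrite !mulr_sumr -big_split/=; apply: ler_sum => j _.
apply: le_trans (mittag_leffler_rate_convex _ (nu_in01 j) _ _ _ s01).
apply: mittag_leffler_rate_le; first exact: nu_in01.
rewrite /clock_exponent !(mulrCA _ (c j)) -mulrDr ler_pM2l//.
case: unlift => [i|]; first exact: kk.
by rewrite !mulr_sumr -big_split/=; apply: ler_sum.
Qed.

Lemma Psi_interior0 :
  (forall i, \forall theta \near (0 : R), kappa i theta \is a fin_num) ->
  (interior (effective_domain (Psi kappa c nu))) 0.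
Proof.
move=> kfin.
have H i : \forall r \near (0 : R)^'+,
    forall theta, `|theta| < r -> kappa i theta \is a fin_num.
  have /nbhs_ballP[e /= e0 He] := kfin i.
  near=> r.
  have re : r < e by near: r; exact: nbhs_right_lt.
  by move=> theta tr; apply: He; rewrite -ball_normE /= sub0r normrN (lt_trans tr).
have : \forall r \near (0 : R)^'+, 0 < r /\ forall i,
    forall theta, `|theta| < r -> kappa i theta \is a fin_num.
  near=> r; split; first by near: r; exact: nbhs_right_gt.
  by near: r; exact: filter_forall.
move=> /filter_ex[r [r0 Hr]]; apply/nbhs_rVP; exists r => // y Hy.
have kE i : kappa i (y 0 i) = (fine (kappa i (y 0 i)))%:E.
  by rewrite fineK// Hr//; have := Hy i; rewrite mxE subr0.
by rewrite /effective_domain/= (Psi_EFin _ _ kE) ltry.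
Unshelve. all: by end_near. Qed.

End PsiProperties.

Section ProcessSigmaAlgebra.
Context {R : realType} {d : measure_display} {T : measurableType d}.

Lemma process_sigma_algebraP (X : R -> T -> R) : sigma_algebra setT (process_sigma_algebra X).
Proof. exact: smallest_sigma_algebra. Qed.

Lemma process_sigma_algebra_measurable (X : R -> T -> R) :
  (forall t, 0 <= t -> measurable_fun setT (X t)) ->
  process_sigma_algebra X `<=` measurable.
Proof.
move=> mX; apply: smallest_sub; first exact: sigma_algebra_measurable.
by move=> _ [t /= t0 [B mB <-]]; exact: mX.
Qed.

Lemma process_sigma_algebra_preimage (X : R -> T -> R) t B : 0 <= t -> measurable B ->
  process_sigma_algebra X (X t @^-1` B).
Proof.
move=> t0 mB; apply: sub_sigma_algebra; exists t => //; exists B => //.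
by rewrite setTI.
Qed.

End ProcessSigmaAlgebra.

Section TimeChange.
Context {R : realType} {d : measure_display} {T : measurableType d}.
Variables (P : probability T R) (h : nat) (c nu : 'I_h.+1 -> R).
Hypothesis c_gt0 : forall i, 0 < c i.
Variables (S : 'I_h -> R -> T -> R) (D L : 'I_h.+1 -> R -> T -> R).
Hypothesis S_levy : forall i, levy_process P (S i).
Hypothesis D_stable : forall j, stable_subordinator P (nu j) (D j).
Hypothesis L_inverse : forall j t w, 0 <= t -> L j t w = inverse_process (D j) t w.
Let X (k : 'I_h + 'I_h.+1) := match k with inl i => S i | inr j => L j end.
Hypothesis SL_independent : independent_processes P X.

Let LE j t : 0 <= t -> L j t = inverse_process (D j) t.
Proof. by move=> t0; apply/funext => w; exact: L_inverse. Qed.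

Let L_ge0 j t w : 0 <= t -> 0 <= L j t w.
Proof. by move=> t0; rewrite L_inverse//; exact: inverse_process_ge0. Qed.

Let mX k t : 0 <= t -> measurable_fun setT (X k t).
Proof.
move=> t0; case: k => [i|j] /=; first exact: (levy_measurable (S_levy i)).
by rewrite LE//; exact: (measurable_inverse_process P _ _ (D_stable j)).
Qed.

Let F k := process_sigma_algebra (X k).

Let F_alg k : sigma_algebra setT (F k).
Proof. exact: process_sigma_algebraP. Qed.

Let F_meas k : F k `<=` measurable.
Proof. by apply: process_sigma_algebra_measurable; exact: mX. Qed.

Let clock (i : 'I_h) (t : R) (w : T) :=
  c (lift ord0 i) * L (lift ord0 i) t w + c ord0 * L ord0 t w.

Let clock_ge0 i t w : 0 <= t -> 0 <= clock i t w.
Proof. by move=> t0; rewrite addr_ge0// mulr_ge0 ?L_ge0// ltW. Qed.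

Lemma measurable_time_changed t i : 0 < t ->
  measurable_fun setT (fun w => time_changed S L c t w 0 i).
Proof.
move=> t0; rewrite /time_changed; under eq_fun do rewrite mxE.
apply: measurable_funM => //.
have mL j : measurable_fun setT (L j t) by exact: (mX (inr j) t (ltW t0)).
have mc : measurable_fun setT (clock i t).
  by apply: measurable_funD; exact: measurable_funM.
have := measurable_random_time (S i) (clock i t) (levy_measurable (S_levy i))
  (levy_cadlag (S_levy i)) mc (fun w => clock_ge0 i t w (ltW t0)).
move=> mS; have := measurable_fun_pair (@measurable_id _ T setT) (@measurable_id _ T setT).
exact: (measurableT_comp mS).
Qed.

Let exp_pre (a t : R) k B : 0 <= t -> measurable B ->
  F k ((fun w => expR (a * X k t w)) @^-1` B).
Proof.
move=> t0 mB.
have mg : measurable_fun setT (fun x : R => expR (a * x)).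
  by apply: measurableT_comp => //; exact: measurable_funM.
rewrite (_ : _ @^-1` B = X k t @^-1` ((fun x : R => expR (a * x)) @^-1` B))//.
apply: process_sigma_algebra_preimage => //.
by rewrite -[_ @^-1` _]setTI; exact: mg.
Qed.

(** A coefficient [a k = 0] turns the k-th factor into 1; in this way the same statement serves the
    processes [S i] alone and the clocks alone. *)
Let prod_expectation (a s : 'I_h + 'I_h.+1 -> R) : (forall k, 0 <= s k) ->
  (\int[P]_w (\prod_k expR (a k * X k (s k) w))%:E =
   \prod_k \int[P]_w (expR (a k * X k (s k) w))%:E)%E.
Proof.
move=> s0.
have := @expectation_prod_independent _ _ _ P _ F (fun k w => expR (a k * X k (s k) w))
  [set: 'I_h + 'I_h.+1]%SET SL_independent F_alg F_meas.
move=> /(_ (fun k B mB => exp_pre (a k) (s k) k B (s0 k) mB)) /(_ (fun k w => expR_ge0 _)).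
rewrite [RHS](eq_bigl predT); last by move=> k; rewrite inE.
move=> <-; apply: eq_integral => w _; congr EFin; apply: eq_bigl => k; by rewrite inE.
Qed.

Lemma time_changed_mgf (theta : 'rV[R]_h) (k : 'I_h -> R) t : 0 < t ->
  (forall i, log_mgf P (S i 1) (theta 0 i) = (k i)%:E) ->
  (\int[P]_w (expR (t * dotr theta (time_changed S L c t w)))%:E =
   \prod_j \int[P]_w (expR (clock_exponent c k j * inverse_process (D j) t w))%:E)%E.
Proof.
move=> t0 kE; have t0' := ltW t0.
have M1 i : (\int[P]_w (expR (theta 0 i * S i 1 w))%:E = (expR (k i))%:E)%E.
  by apply: log_mgf_fin (kE i); exact: (levy_measurable (S_levy i)).
(* [T1] and [T2] are [T] with the sigma-algebras generated by the [S i] and by the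
   [L j], which makes the two identity maps independent random elements. *)
pose J1 := [set inl i | i : 'I_h]%SET : {set 'I_h + 'I_h.+1}.
pose J2 := [set inr j | j : 'I_h.+1]%SET : {set 'I_h + 'I_h.+1}.
pose G1 := \bigcup_(k in [set` J1]) F k.
pose G2 := \bigcup_(k in [set` J2]) F k.
pose T1 := g_sigma_algebraType G1; pose T2 := g_sigma_algebraType G2.
have Gm (J : {set 'I_h + 'I_h.+1}) :
    <<s \bigcup_(k in [set` J]) F k >> `<=` @measurable _ T.
  apply: smallest_sub; first exact: sigma_algebra_measurable.
  by move=> A [k' _ Fk]; exact: F_meas Fk.
have id1 : measurable_fun setT (idfun : T -> T1).
  by move=> _ A mA; rewrite setTI; exact: (Gm J1).
have id2 : measurable_fun setT (idfun : T -> T2).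
  by move=> _ A mA; rewrite setTI; exact: (Gm J2).
have mS1 i s : 0 <= s -> measurable_fun setT (S i s : T1 -> R).
  move=> s0 _ B mB; rewrite setTI; apply: sub_sigma_algebra.
  exists (inl i); first by apply/imsetP; exists i.
  exact: (process_sigma_algebra_preimage (S i)).
have mL2 j : measurable_fun setT (L j t : T2 -> R).
  move=> _ B mB; rewrite setTI; apply: sub_sigma_algebra.
  exists (inr j); first by apply/imsetP; exists j.
  exact: (process_sigma_algebra_preimage (L j)).
pose f (z : T1 * T2) : \bar R :=
  (expR (\sum_i theta 0 i * S i (clock i t z.2) z.1))%:E.
have mf : measurable_fun setT f.
  apply/measurable_EFinP; apply: measurableT_comp => //.
  apply: measurable_sum => i; apply: measurable_funM => //.
  apply: (@measurable_random_time R _ _ T1 T2 (S i) (clock i t)).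
  - by move=> s s0; exact: mS1.
  - exact: (levy_cadlag (S_levy i)).
  - by apply: measurable_funD; apply: measurable_funM.
  - by move=> w; exact: clock_ge0.
transitivity (\int[P]_w f (w, w))%E.
  apply: eq_integral => w _; congr (expR _)%:E; rewrite mulr_sumr.
  by apply: eq_bigr => i _; rewrite mxE mulrCA [t * _]mulrC divfK ?gt_eqF.
rewrite (independent_fubini P (idfun : T -> T1) (idfun : T -> T2) f id1 id2); last 3 first.
- move=> A B mA mB; rewrite /preimage/=.
  apply: (independent_groups P F J1 J2 SL_independent F_alg F_meas) => //.
  by move=> k' /imsetP[i _ ->]; apply/imsetP => -[].
- exact: mf.
- by move=> z; rewrite lee_fin expR_ge0.
(* With the clocks frozen at [w'], the Lévy processes are sampled at deterministic times, where
   [levy_exp_moment] applies. *)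
transitivity (\int[P]_w' (\prod_(k' : 'I_h + 'I_h.+1)
    expR ((if k' is inr j then clock_exponent c k j else 0) * X k' t w'))%:E)%E.
  apply: eq_integral => w' _.
  transitivity (\int[P]_w (\prod_(k' : 'I_h + 'I_h.+1)
      expR ((if k' is inl i then theta 0 i else 0) *
            X k' (if k' is inl i then clock i t w' else 0) w))%:E)%E.
    apply: eq_integral => w _; congr EFin; rewrite big_sumType/= [X in _ * X]big1.
      by rewrite mulr1 -expR_sum.
    by move=> j _; rewrite mul0r expR0.
  rewrite (prod_expectation (fun k' => if k' is inl i then theta 0 i else 0)
    (fun k' => if k' is inl i then clock i t w' else 0)); last first.
    by case=> [i|j] //; exact: clock_ge0.
  rewrite big_sumType/= [X in (_ * X)%E]big1 ?mule1; last first.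
    move=> j _; under eq_integral do rewrite mul0r expR0.
    by rewrite integral_cst//= mul1e [P _]probability_setT.
  rewrite big_sumType/= [X in X * _]big1 ?mul1r; last by move=> i _; rewrite mul0r expR0.
  transitivity (\prod_(i < h) (expR (clock i t w' * k i))%:E)%E.
    apply: eq_bigr => i _.
    by rewrite (levy_exp_moment P (S i) (S_levy i) _ _ (M1 i) _ (clock_ge0 i t w' t0')).
  rewrite prodEFin; congr EFin; rewrite -!expR_sum; congr expR.
  (* The exponent is regrouped by clock: the common clock collects the sum of all [k i], each own
     clock a single one. *)
  rewrite big_ord_recl /clock_exponent unlift_none addrC /clock.
  under eq_bigr => i _ do rewrite mulrDl.
  rewrite big_split/=; congr (_ + _).
    by apply: eq_bigr => i _; rewrite liftK mulrAC.
  by rewrite -mulr_sumr mulrAC.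
rewrite (prod_expectation (fun k' => if k' is inr j then clock_exponent c k j else 0)
    (fun=> t)); last by [].
rewrite big_sumType/= [X in (X * _)%E]big1 ?mul1e; last first.
  move=> j _; under eq_integral do rewrite mul0r expR0.
  by rewrite integral_cst//= mul1e [P _]probability_setT.
by apply: eq_bigr => j _; apply: eq_integral => w _; rewrite L_inverse.
Qed.

End TimeChange.

Lemma lee_prod_nonneg {R : realType} {I : finType} (f g : I -> \bar R) :
  (forall i, 0 <= f i)%E -> (forall i, f i <= g i)%E ->
  (\prod_i f i <= \prod_i g i)%E.
Proof.
move=> f0 fg.
suff [] : (0 <= \prod_i f i)%E /\ (\prod_i f i <= \prod_i g i)%E by [].
elim/big_ind2 : _ => [|a b a' b' [a0 ab] [b0 bb]|i _]; first by rewrite lexx lee_fin.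
- by split; [exact: mule_ge0|exact: lee_pmul].
- by split; [exact: f0|exact: fg].
Qed.

Section ClockProduct.
Context {R : realType} {d : measure_display} {T : measurableType d}.
Variables (P : probability T R) (n : nat) (nu : 'I_n.+1 -> R) (D : 'I_n.+1 -> R -> T -> R).
Hypothesis nu_in01 : forall i, 0 < nu i < 1.
Hypothesis D_stable : forall j, stable_subordinator P (nu j) (D j).
Variable xi : 'I_n.+1 -> R.

Let rate := \sum_j mittag_leffler_rate (nu j) (xi j).

Let moment j t := (\int[P]_w (expR (xi j * inverse_process (D j) t w))%:E)%E.

Let moment_ge0 j t : (0 <= moment j t)%E.
Proof. by apply: integral_ge0 => w _; rewrite lee_fin expR_ge0. Qed.

(** The error [e] is shared equally among the n + 1 clocks, so that the product of the individual
    bounds has total error exactly [e]. *)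
Let rateE (C : 'I_n.+1 -> R) e t :
  (\prod_j (C j * expR ((mittag_leffler_rate (nu j) (xi j) + e / n.+1%:R) * t))%:E)%E =
  (\prod_j C j * expR ((rate + e) * t))%:E.
Proof.
rewrite prodEFin big_split/= -expR_sum; congr (_ * expR _)%:E.
rewrite -mulr_suml big_split/= sumr_const card_ord; congr ((_ + _) * _).
by rewrite -[e / _ *+ _]mulr_natr divfK// pnatr_eq0.
Qed.

Lemma clock_moments_upper eta : 0 < eta ->
  exists2 C, 0 < C & \forall t \near +oo,
    (\prod_j moment j t <= (C * expR ((rate + eta) * t))%:E)%E.
Proof.
move=> eta0; have e0 : 0 < eta / n.+1%:R by rewrite divr_gt0.
have H j := inverse_exp_moment_upper P (nu j) (D j) (nu_in01 j) (D_stable j) (xi j) _ e0.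
pose C j := sval (cid2 (H j)).
have C0 j : 0 < C j by rewrite /C; case: cid2.
exists (\prod_j C j); first exact: prodr_gt0.
near=> t; have t0 : 0 <= t by near: t; exact: nbhs_pinfty_ge.
rewrite -rateE; apply: lee_prod_nonneg => // j.
by rewrite /C; case: cid2 => /= ? _; exact.
Unshelve. all: by end_near. Qed.

Lemma clock_moments_lower eta : 0 < eta ->
  exists2 C, 0 < C & \forall t \near +oo,
    ((C * expR ((rate - eta) * t))%:E <= \prod_j moment j t)%E.
Proof.
move=> eta0; have e0 : 0 < eta / n.+1%:R by rewrite divr_gt0.
exists (\prod_(j < n.+1) 2^-1); first by apply: prodr_gt0 => j _; rewrite invr_gt0.
near=> t.
have H : forall j, ((2^-1 * expR ((mittag_leffler_rate (nu j) (xi j) - eta / n.+1%:R) * t))%:E <=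
    moment j t)%E.
  near: t; apply: filter_forall => j.
  exact: (inverse_exp_moment_lower P (nu j) (D j) (nu_in01 j) (D_stable j)).
rewrite -rateE; apply: lee_prod_nonneg => j.
  by rewrite lee_fin mulr_ge0 ?expR_ge0// invr_ge0.
by rewrite mulNr; exact: H.
Unshelve. all: by end_near. Qed.

End ClockProduct.

Theorem proposition3p1 (R : realType) (d : measure_display)
  (T : measurableType d) (P : probability T R)
  (h : nat) (h_ge1 : (1 <= h)%N)
  (c nu : 'I_h.+1 -> R)
  (c_gt0 : forall i, 0 < c i)
  (nu_in01 : forall i, 0 < nu i /\ nu i < 1)
  (S : 'I_h -> R -> T -> R) (L : 'I_h.+1 -> R -> T -> R)
  (S_levy : forall i, levy_process P (S i))
  (kappa_fin : forall i,
     \forall theta \near (0 : R), log_mgf P (S i 1) theta \is a fin_num)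
  (L_inverse : forall j, inverse_stable_subordinator P (nu j) (L j))
  (SL_independent : independent_processes P
     (fun k : 'I_h + 'I_h.+1 =>
        match k with inl i => S i | inr j => L j end))
  (Psi_smooth : essentially_smooth (Psi (fun i => log_mgf P (S i 1)) c nu))
  (Psi_lsc : lower_semicontinuous (Psi (fun i => log_mgf P (S i 1)) c nu)) :
  large_deviation_principle P (time_changed S L c) (fun t => t)
    (legendre_transform (Psi (fun i => log_mgf P (S i 1)) c nu)).
Proof.
have nu01 i : 0 < nu i < 1 by apply/andP; exact: nu_in01.
pose D j := s2val (cid2 (L_inverse j)).
have D_stable j : stable_subordinator P (nu j) (D j) by rewrite /D; case: cid2.
have LD j t w : 0 <= t -> L j t w = inverse_process (D j) t w.
  by rewrite /D; case: cid2 => /= ? _; exact.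
have mS i : measurable_fun setT (S i 1) by exact: (levy_measurable (S_levy i)).
have kNy i theta : (-oo < log_mgf P (S i 1%R) theta)%E by exact: log_mgf_gtNy.
have Psi_mgf (theta : 'rV[R]_h) y : Psi (fun i => log_mgf P (S i 1)) c nu theta = y%:E ->
    exists2 xi, y = \sum_j mittag_leffler_rate (nu j) (xi j) & forall t, 0 < t ->
      (\int[P]_w (expR (t * dotr theta (time_changed S L c t w)))%:E =
       \prod_j \int[P]_w (expR (xi j * inverse_process (D j) t w))%:E)%E.
  move=> Py; have [|k kE] := Psi_lty_fin _ c nu c_gt0 nu01 kNy theta.
    by rewrite Py ltry.
  exists (clock_exponent c k).
    by apply: EFin_inj; rewrite -Py; exact: Psi_EFin.
  by move=> t t0; exact: (time_changed_mgf P h c nu c_gt0 S D L S_levy D_stable LD).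
apply: gartner_ellis => //.
- by move=> t t0 i; exact: (measurable_time_changed P h c nu c_gt0 S D L S_levy D_stable LD).
- by move=> theta; exact: Psi_ge0.
- by apply: Psi0 => // i; exact: log_mgf0.
- by apply: Psi_convex => // i s a b ka kb; exact: log_mgf_convex.
- exact: Psi_interior0.
- move=> theta y eta /Psi_mgf[xi -> mgfE] eta0.
  have [C C0 HC] := clock_moments_upper P h nu D nu01 D_stable xi eta eta0.
  exists C => //; near=> t; rewrite mgfE; first by near: t.
  by near: t; exact: nbhs_pinfty_gt.
- move=> theta y eta /Psi_mgf[xi -> mgfE] eta0.
  have [C C0 HC] := clock_moments_lower P h nu D nu01 D_stable xi eta eta0.
  exists C => //; near=> t; rewrite mgfE; first by near: t.
  by near: t; exact: nbhs_pinfty_gt.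
Unshelve. all: by end_near. Qed.
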